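(* Let $\boldsymbol x_o\in\mathbb C^d$, let $f_1,\dots,f_n$ be holomorphic functions of $\boldsymbol x=(x^1,\dots,x^d)$ in a neighborhood of $\boldsymbol x_o$, and let $b_1,\dots,b_n\in\mathbb C$. Assume that - for any $k,h=1,\dots,n$ with $k\neq h$, we have $\mathrm d_{\boldsymbol x_o}f_k\neq\mathrm d_{\boldsymbol x_o}f_h$; - $b_h-b_k\notin\mathbb Z\setminus\{0\}$ whenever $f_h(\boldsymbol x_o)=f_k(\boldsymbol x_o)$. If $F_1,F_2\in M(n,\mathbb C)[\![(x^i-x^i_o)_{i=1}^d]\!]$ are two formal power series solutions (with zero diagonal) of the generalized Darboux–Egoroff system ${\rm DE}_{d,n}((f_i)_{i=1}^n;(b_i)_{i=1}^n)$ such that $F_1(\boldsymbol x_o)=F_2(\boldsymbol x_o)$, then $F_1=F_2$. In particular, given an initial condition $F_o\in M(n,\mathbb C)$ with zero diagonal, there exists at most one holomorphic solution $F$ (near $\boldsymbol x_o$) of ${\rm DE}_{d,n}((f_i)_{i=1}^n;(b_i)_{i=1}^n)$ such that $F(\boldsymbol x_o)=F_o$.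
   Context: Write $\partial_i=\partial/\partial x^i$. The generalized Darboux–Egoroff system ${\rm DE}_{d,n}((f_i)_{i=1}^n;(b_i)_{i=1}^n)$ is the following system of PDEs for $n^2-n$ unknown functions $F_{kh}(\boldsymbol x)$, $k,h=1,\dots,n$, $k\neq h$ (arranged in an off-diagonal $n\times n$ matrix $F$): $$(\partial_jf_h-\partial_jf_k)\,\partial_iF_{kh}-(\partial_if_h-\partial_if_k)\,\partial_jF_{kh}=\sum_{\ell=1}^n(\partial_if_\ell-\partial_if_k)(\partial_jf_h-\partial_jf_\ell)F_{k\ell}F_{\ell h}-\sum_{\ell=1}^n(\partial_jf_\ell-\partial_jf_k)(\partial_if_h-\partial_if_\ell)F_{k\ell}F_{\ell h},$$ $$(f_h-f_k)\,\partial_iF_{kh}=(b_h-b_k-1)(\partial_if_h-\partial_if_k)F_{kh}+\sum_{\ell=1}^n(\partial_if_\ell-\partial_if_k)(f_h-f_\ell)F_{k\ell}F_{\ell h}-\sum_{\ell=1}^n(f_\ell-f_k)(\partial_if_h-\partial_if_\ell)F_{k\ell}F_{\ell h},$$ for any $i,j=1,\dots,d$ and any $k,h=1,\dots,n$ with $k\neq h$ (terms with $\ell=k$ or $\ell=h$ vanish; $F_{kk}:=0$). For formal power series solutions the $f_i$ are replaced by their Taylor expansions at $\boldsymbol x_o$. *)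

(* Defs.v *)
From HB Require Import structures.
From mathcomp Require Import all_boot all_order all_algebra.
From mathcomp Require Import complex.
From mathcomp Require Import all_classical all_reals all_analysis.

Set Implicit Arguments.
Unset Strict Implicit.
Unset Printing Implicit Defensive.

Import Order.TTheory GRing.Theory Num.Theory.
Import numFieldNormedType.Exports.

Local Open Scope classical_set_scope.
Local Open Scope ring_scope.

(* [R[i]] bundled as a [numClosedFieldType], so that it inherits the topology,
   the norm and the notion of derivative that MathComp-Analysis attaches to
   such fields. *)
Definition cplx (R : realType) : numClosedFieldType := R[i].

Section SeveralComplexVariables.
Variables (R : realType) (d : nat).
Local Notation C := (cplx R).

(* Complex Frechet differentiability at every point of some neighborhood of
   [x0]; the values of [f] far from [x0] are irrelevant. *)
Definition holomorphic_near (f : 'rV[C]_d -> C) (x0 : 'rV[C]_d) : Prop :=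
  \forall x \near x0, differentiable f x.

Definition partial (i : 'I_d) (f : 'rV[C]_d -> C) : 'rV[C]_d -> C :=
  'D_'e_i f.

Definition multi_index : Type := {ffun 'I_d -> nat}.

(* Composed in the fixed order d_0^(al 0) (d_1^(al 1) ( ... f)). *)
Definition mpartial (al : multi_index) (f : 'rV[C]_d -> C) : 'rV[C]_d -> C :=
  foldr (fun i g => iter (al i) (partial i) g) f (enum 'I_d).

(* A formal power series in the d variables x^i - x0^i is identified with its
   family of coefficients. *)
Definition fps (A : Type) : Type := multi_index -> A.

Definition mindex0 : multi_index := [ffun=> 0%N].

Definition mindex_incr (i : 'I_d) (al : multi_index) : multi_index :=
  [ffun j => (al j + (j == i))%N].

(* Cauchy product: the sum runs over all be <= al; the bound |al| only serves
   to have a finite index type. *)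
Definition fps_mul (a b : fps C) : fps C := fun al =>
  \sum_(be : {ffun 'I_d -> 'I_(\sum_i al i)%N.+1} | [forall i, be i <= al i]%N)
     a [ffun i => be i : nat] * b [ffun i => (al i - be i)%N].

Definition fps_deriv (i : 'I_d) (a : fps C) : fps C := fun al =>
  (al i).+1%:R * a (mindex_incr i al).

Definition taylor (x0 : 'rV[C]_d) (f : 'rV[C]_d -> C) : fps C := fun al =>
  mpartial al f x0 / (\prod_i (al i)`!)%N%:R.

End SeveralComplexVariables.

Section DarbouxEgoroff.
Variables (R : realType) (d n : nat).
Local Notation C := (cplx R).

(* The equations DE_{d,n}, written once as relations between the elements
   f_k, df i k = d_i f_k, F_kh and dF i k h = d_i F_kh of a C-module A with
   product [mul]. They are used below with A = C (values at a point) and with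
   A = C[[x - x0]]. *)
Definition DE_equations (A : lmodType C) (mul : A -> A -> A)
    (f : 'I_n -> A) (df : 'I_d -> 'I_n -> A) (b : 'I_n -> C)
    (F : 'I_n -> 'I_n -> A) (dF : 'I_d -> 'I_n -> 'I_n -> A) : Prop :=
  (forall (i j : 'I_d) (k h : 'I_n), k != h ->
    mul (df j h - df j k) (dF i k h) - mul (df i h - df i k) (dF j k h) =
    \sum_(l < n) mul (mul (df i l - df i k) (df j h - df j l))
                     (mul (F k l) (F l h))
    - \sum_(l < n) mul (mul (df j l - df j k) (df i h - df i l))
                       (mul (F k l) (F l h)))
  /\
  (forall (i : 'I_d) (k h : 'I_n), k != h ->
    mul (f h - f k) (dF i k h) =
    (b h - b k - 1) *: mul (df i h - df i k) (F k h)
    + \sum_(l < n) mul (mul (df i l - df i k) (f h - f l))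
                       (mul (F k l) (F l h))
    - \sum_(l < n) mul (mul (f l - f k) (df i h - df i l))
                       (mul (F k l) (F l h))).

Definition formal_DE_solution (x0 : 'rV[C]_d) (f : 'I_n -> 'rV[C]_d -> C)
    (b : 'I_n -> C) (F : fps d 'M[C]_n) : Prop :=
  let fhat k : fps d C := taylor x0 (f k) in
  let Fhat k h : fps d C := fun al => F al k h in
  (forall al k, F al k k = 0) /\
  @DE_equations (multi_index d -> C^o) (@fps_mul R d)
    fhat (fun i k => fps_deriv i (fhat k)) b
    Fhat (fun i k h => fps_deriv i (Fhat k h)).

Definition holomorphic_DE_solution (x0 : 'rV[C]_d) (f : 'I_n -> 'rV[C]_d -> C)
    (b : 'I_n -> C) (F : 'rV[C]_d -> 'M[C]_n) : Prop :=
  [/\ forall k h, holomorphic_near (fun x => F x k h) x0,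
      \forall x \near x0, forall k, F x k k = 0 &
      \forall x \near x0,
        @DE_equations C^o *%R
          (fun k => f k x) (fun i k => partial i (f k) x) b
          (fun k h => F x k h) (fun i k h => partial i (fun y => F y k h) x)].

End DarbouxEgoroff.

(* Main.v *)
(* Only the second family of equations is needed. Let G be the difference of
   two solutions, so that G_kh satisfies a linear equation
     (f_h - f_k) d_i G_kh = (b_h - b_k - 1) d_i(f_h - f_k) G_kh + ...
   whose coupling terms involve the products G_kl F_lh and F_kl G_lh.

   Formal solutions: if all G_kh have order >= m >= 1, the homogeneous part P of
   degree m of G_kh vanishes. When f_h(x0) <> f_k(x0) the coefficients of degree
   m - 1 of the equation say that all d_i P are 0. When f_h(x0) = f_k(x0), the
   coupling terms do not contribute in degree m, so that
   L d_i P = (b_h - b_k - 1) L_i P with L = d(f_h - f_k)(x0); for an index i with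
   L_i <> 0, descending induction on the exponent of x_i kills P, because
   b_h - b_k - 1 is not a nonnegative integer.

   Holomorphic solutions: the same induction is run on the orders of vanishing at
   t = 0 of G_kh(x0 + t v), for v such that the numbers d(f_k)(x0) v are distinct.
   A flat holomorphic function vanishes on a disc whose radius does not depend on
   v, and such v are dense. The one-variable facts rest on a maximum modulus
   principle allowing exceptional points, proved from Goursat's theorem for
   dyadic Riemann sums along parallelograms, without integrals: a bounded
   holomorphic function on a punctured disc is Lipschitz, because the principle
   applies to its difference quotients. *)

Require Import Defs.
From mathcomp Require Import all_boot all_order all_algebra.
From mathcomp Require Import complex ring zify.
From mathcomp Require Import all_classical all_reals all_analysis.

Set Implicit Arguments.
Unset Strict Implicit.
Unset Printing Implicit Defensive.

Import Order.TTheory GRing.Theory Num.Theory.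
Import numFieldNormedType.Exports.

Local Open Scope classical_set_scope.
Local Open Scope ring_scope.

(** * Formal power series *)

Section FormalSeries.
Variables (R : realType) (d : nat).
Local Notation C := (cplx R).
Local Notation fpsC := (multi_index d -> C^o).
Implicit Types (a b : fpsC) (al be : multi_index d) (p q : nat).

Definition mdeg al : nat := (\sum_i al i)%N.

Definition mindex_sub al be : multi_index d := [ffun i => (al i - be i)%N].

Definition ord_ge p a : Prop := forall al, (mdeg al < p)%N -> a al = 0.

Lemma mdeg0 : mdeg (mindex0 d) = 0%N.
Proof. by rewrite /mdeg big1// => i _; rewrite ffunE. Qed.

Lemma mdeg_eq0 al : mdeg al = 0%N -> al = mindex0 d.
Proof.
move/eqP; rewrite sum_nat_eq0 => /forallP h; apply/ffunP => i.
by rewrite ffunE; apply/eqP; have := h i.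
Qed.

Lemma mdeg_incr i al : mdeg (mindex_incr i al) = (mdeg al).+1.
Proof.
rewrite /mdeg (eq_bigr (fun j => al j + (j == i))%N); last by move=> j _; rewrite ffunE.
rewrite big_split/= -addn1; congr addn.
by rewrite (bigD1 i)//= eqxx big1 ?addn0// => j /negbTE ->.
Qed.

Lemma mdeg_sub al be : (forall i, be i <= al i)%N ->
  (mdeg (mindex_sub al be) + mdeg be = mdeg al)%N.
Proof.
move=> h; rewrite /mdeg -big_split/=; apply: eq_bigr => i _.
by rewrite ffunE subnK.
Qed.

Lemma mindex_incr_sub i al : (0 < al i)%N ->
  mindex_incr i (mindex_sub al (mindex_incr i (mindex0 d))) = al.
Proof.
move=> h; apply/ffunP => j; rewrite !ffunE add0n.
by case: eqVneq => [->|_]; rewrite ?subn0 ?addn0// subnK.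
Qed.

Lemma mdeg_gt0 al : (0 < mdeg al)%N -> exists i, (0 < al i)%N.
Proof.
rewrite lt0n => h; apply/existsP; apply: contraR h.
rewrite negb_exists => /forallP h; apply/eqP/big1 => i _.
by apply/eqP; rewrite -leqn0 leqNgt h.
Qed.

Lemma mdeg1P al : mdeg al = 1%N -> exists i, al = mindex_incr i (mindex0 d).
Proof.
move=> h; have [i hi] : exists i, (0 < al i)%N by apply: mdeg_gt0; rewrite h.
exists i; rewrite -[LHS](mindex_incr_sub hi); congr mindex_incr.
apply: mdeg_eq0; apply/eqP; rewrite -eqSS -(mdeg_incr i) mindex_incr_sub//.
by rewrite h.
Qed.

(** This lemma and [fps_mul_single] hide the bounded index type of [fps_mul]: their hypotheses range
    over plain multi-indices below [al]. *)
Lemma fps_mul_eq0 a b al :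
  (forall be, (forall i, be i <= al i)%N -> a be * b (mindex_sub al be) = 0) ->
  fps_mul a b al = 0.
Proof.
move=> h; rewrite /fps_mul big1// => be /forallP hbe.
have := h [ffun i => be i : nat]; rewrite /mindex_sub.
set x := [ffun i => (al i - _)%N]; set y := [ffun i => (al i - _)%N].
have -> : x = y by apply/ffunP => i; rewrite !ffunE.
by apply=> i; rewrite ffunE.
Qed.

Lemma fps_mul_single a b al be0 : (forall i, be0 i <= al i)%N ->
  (forall be, (forall i, be i <= al i)%N -> be != be0 ->
     a be * b (mindex_sub al be) = 0) ->
  fps_mul a b al = a be0 * b (mindex_sub al be0).
Proof.
move=> h0 h; have hlt i : (be0 i < (\sum_i al i).+1)%N.
  by rewrite ltnS (leq_trans (h0 i))// (bigD1 i)//= leq_addr.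
pose g : {ffun 'I_d -> 'I_(\sum_i al i)%N.+1} := [ffun i => Ordinal (hlt i)].
have gE : [ffun i => g i : nat] = be0 by apply/ffunP => i; rewrite !ffunE.
have subE (be : {ffun 'I_d -> 'I_(\sum_i al i)%N.+1}) :
    [ffun i => (al i - be i)%N] = mindex_sub al [ffun i => be i : nat].
  by apply/ffunP => i; rewrite !ffunE.
rewrite /fps_mul (bigD1 g)/=; last first.
  by apply/forallP => i; rewrite ffunE; apply: h0.
rewrite subE gE big1 ?addr0// => be /andP[/forallP hbe neq].
rewrite subE; apply: h => [i|]; first by rewrite ffunE.
apply: contra neq => /eqP e; apply/eqP/ffunP => i; apply: val_inj.
by rewrite /= -[val (g i)](ffunE (fun i => g i : nat)) gE -e ffunE.
Qed.

Lemma fps_mulBl a a' b : fps_mul (a - a') b = fps_mul a b - fps_mul a' b.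
Proof.
apply/funext => al; rewrite /fps_mul -[RHS]/(_ - _) -sumrB.
by apply: eq_bigr => be _; rewrite -mulrBl.
Qed.

Lemma fps_mulBr a b b' : fps_mul a (b - b') = fps_mul a b - fps_mul a b'.
Proof.
apply/funext => al; rewrite /fps_mul -[RHS]/(_ - _) -sumrB.
by apply: eq_bigr => be _; rewrite -mulrBr.
Qed.

Lemma ord_ge_mul p q a b : ord_ge p a -> ord_ge q b -> ord_ge (p + q) (fps_mul a b).
Proof.
move=> ha hb al hal; apply: fps_mul_eq0 => be hbe.
have [/ha->|hp] := ltnP (mdeg be) p; first by rewrite mul0r.
rewrite hb ?mulr0//.
move: hal; rewrite -(mdeg_sub hbe) => hal.
by rewrite -(ltn_add2r (mdeg be)) (leq_trans hal)// addnC leq_add2l.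
Qed.

(** Any [be] other than 0 leaves for [b] an index of degree below [q], where [b] vanishes. *)
Lemma fps_mul_ordr q a b al : ord_ge q b -> mdeg al = q ->
  fps_mul a b al = a (mindex0 d) * b al.
Proof.
move=> hb hal; rewrite (@fps_mul_single _ _ _ (mindex0 d)).
- by congr (_ * b _); apply/ffunP => i; rewrite !ffunE subn0.
- by move=> i; rewrite ffunE.
move=> be hbe neq; rewrite hb ?mulr0// -hal -(mdeg_sub hbe) -addn1 leq_add2l.
by rewrite lt0n; apply: contra neq => /eqP/mdeg_eq0 ->.
Qed.

Lemma fps_mul_ordl q a b al : ord_ge q a -> mdeg al = q ->
  fps_mul a b al = a al * b (mindex0 d).
Proof.
move=> ha hal; rewrite (@fps_mul_single _ _ _ al)//.
  by congr (_ * b _); apply/ffunP => i; rewrite !ffunE subnn.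
move=> be hbe neq; have [h|h] := ltnP (mdeg be) q; first by rewrite ha// mul0r.
exfalso; move/eqP: neq; apply; apply/ffunP => i.
have := mdeg_sub hbe; rewrite hal => e.
have /mdeg_eq0/ffunP/(_ i) : mdeg (mindex_sub al be) = 0%N.
  by apply/eqP; rewrite -leqn0 -(leq_add2r (mdeg be)) e add0n.
by rewrite !ffunE => /eqP e'; apply/eqP; rewrite eqn_leq hbe -subn_eq0.
Qed.

Lemma ord_ge_sub p a b : ord_ge p a -> ord_ge p b -> ord_ge p (a - b).
Proof. by move=> ha hb al h; rewrite -[LHS]/(a al - b al) ha// hb// subr0. Qed.

Lemma ord_ge_sum (I : finType) p (a : I -> fpsC) :
  (forall i, ord_ge p (a i)) -> ord_ge p (\sum_i a i).
Proof.
move=> h; apply: (big_ind (ord_ge p)) => // x y hx hy al hal.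
by rewrite -[LHS]/(x al + y al) hx// hy// addr0.
Qed.

Lemma fps_deriv_sub i a b : fps_deriv i (a - b) = fps_deriv i a - fps_deriv i b.
Proof. by apply/funext => al; rewrite /fps_deriv -mulrBr. Qed.

Lemma ord_ge_deriv p i a : ord_ge p a -> ord_ge p.-1 (fps_deriv i a).
Proof.
move=> h al hal; rewrite /fps_deriv h ?mulr0// mdeg_incr.
by case: p h hal.
Qed.

End FormalSeries.

(** * Uniqueness of formal solutions, degree by degree *)

Section FormalUniqueness.
Variables (R : realType) (d n : nat).
Local Notation C := (cplx R).
Local Notation fpsC := (multi_index d -> C^o).
Local Notation e_ i := (mindex_incr i (mindex0 d)).
Implicit Types a : fpsC.

Let fps_mulBB a a' b b' : fps_mul (a - a') (b - b') =
  fps_mul a b - fps_mul a' b - (fps_mul a b' - fps_mul a' b').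
Proof. by rewrite fps_mulBr !fps_mulBl. Qed.

Variables (f : 'I_n -> fpsC) (b : 'I_n -> C) (F1 F2 : 'I_n -> 'I_n -> fpsC).
Hypothesis f_neq : forall k h, k != h -> exists i, f h (e_ i) != f k (e_ i).
Hypothesis b_nonres : forall k h, f h (mindex0 d) = f k (mindex0 d) ->
  forall m : int, m != 0 -> b h - b k <> m%:~R.
Hypothesis F1_diag : forall k, F1 k k = 0.
Hypothesis F2_diag : forall k, F2 k k = 0.
Let df i k := fps_deriv i (f k).
Hypothesis F1_sol : DE_equations (@fps_mul R d) f df b F1
  (fun i k h => fps_deriv i (F1 k h)).
Hypothesis F2_sol : DE_equations (@fps_mul R d) f df b F2
  (fun i k h => fps_deriv i (F2 k h)).
Hypothesis F12_init : forall k h, F1 k h (mindex0 d) = F2 k h (mindex0 d).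

Let G k h := F1 k h - F2 k h.
(** [D] is the difference of the quadratic terms and [W] their joint coefficient, so that the two
    coupling sums become one in [G_eq]. *)
Let D k h l := fps_mul (F1 k l) (F1 l h) - fps_mul (F2 k l) (F2 l h).
Let W i k h l := fps_mul (df i l - df i k) (f h - f l) -
                 fps_mul (f l - f k) (df i h - df i l).

Let G_eq i k h : k != h ->
  fps_mul (f h - f k) (fps_deriv i (G k h)) =
  (b h - b k - 1) *: fps_mul (df i h - df i k) (G k h) +
  \sum_(l < n) fps_mul (W i k h l) (D k h l).
Proof.
move=> kh; rewrite fps_deriv_sub fps_mulBr.
rewrite F1_sol.2// F2_sol.2// fps_mulBr scalerBr.
rewrite [X in _ = _ + X](eq_bigr (fun l =>
   (fps_mul (fps_mul (df i l - df i k) (f h - f l)) (fps_mul (F1 k l) (F1 l h))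
   - fps_mul (fps_mul (f l - f k) (df i h - df i l)) (fps_mul (F1 k l) (F1 l h)))
   - (fps_mul (fps_mul (df i l - df i k) (f h - f l)) (fps_mul (F2 k l) (F2 l h))
   - fps_mul (fps_mul (f l - f k) (df i h - df i l)) (fps_mul (F2 k l) (F2 l h)))));
  last by move=> l _; exact: fps_mulBB.
by rewrite !sumrB -(addrA (_ *: fps_mul _ (F1 k h))) -(addrA (_ *: fps_mul _ (F2 k h)))
  opprD addrACA.
Qed.

(** Telescoping writes [D] as [G k l * F1 l h + F2 k l * G l h], which is linear in [G]. *)
Let D_ord m k h l : (forall k h, ord_ge m (G k h)) -> ord_ge m (D k h l).
Proof.
move=> hG; have -> : D k h l = fps_mul (G k l) (F1 l h) - fps_mul (F2 k l) (- G l h).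
  rewrite /D /G fps_mulBl opprB fps_mulBr opprB.
  by rewrite addrA subrK.
apply: ord_ge_sub.
  by rewrite -[m]addn0; apply: ord_ge_mul.
rewrite -[m]add0n; apply: ord_ge_mul => // al h'.
by rewrite -[LHS]/(- (G l h al)) hG ?oppr0.
Qed.

Let D_lead m k h l al : (forall k h, ord_ge m (G k h)) -> mdeg al = m ->
  D k h l al = G k l al * F1 l h (mindex0 d) + F2 k l (mindex0 d) * G l h al.
Proof.
move=> hG hal; have -> : D k h l = fps_mul (G k l) (F1 l h) - fps_mul (F2 k l) (- G l h).
  rewrite /D /G fps_mulBl opprB fps_mulBr opprB.
  by rewrite addrA subrK.
rewrite -[LHS]/(_ al - _ al) (fps_mul_ordl _ (hG k l) hal).
rewrite (@fps_mul_ordr _ _ m)//; last first.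
  by move=> be h'; rewrite -[LHS]/(- (G l h be)) hG ?oppr0.
by rewrite -[(- G l h) al]/(- (G l h al)) mulrN opprK.
Qed.

(** Read [G_eq] at [al - e_i], of degree [m]. There [d_i G] has order at least [m], so the left side
    is the nonzero constant term of [f h - f k] times [al i * G_al], while every term on the right
    has order at least [m.+1]. *)
Let regular_step m k h : (forall k h, ord_ge m.+1 (G k h)) ->
  f h (mindex0 d) <> f k (mindex0 d) ->
  forall al, mdeg al = m.+1 -> G k h al = 0.
Proof.
move=> hG fhk al hal.
have kh : k != h by apply/eqP => e; apply: fhk; rewrite e.
have [i hi] : exists i, (0 < al i)%N by apply: mdeg_gt0; rewrite hal.
have := congr1 (fun a => a (mindex_sub al (e_ i))) (G_eq i kh).
have hbe : mdeg (mindex_sub al (e_ i)) = m.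
  by apply/eqP; rewrite -eqSS -(mdeg_incr i) mindex_incr_sub// hal.
rewrite (fps_mul_ordr _ (@ord_ge_deriv _ _ m.+1 i _ (hG k h)) hbe).
rewrite /fps_deriv mindex_incr_sub//.
have -> : ((b h - b k - 1) *: fps_mul (df i h - df i k) (G k h) +
  \sum_(l < n) fps_mul (W i k h l) (D k h l)) (mindex_sub al (e_ i)) = 0.
  set S := \sum_(l < n) _.
  have hS : ord_ge m.+1 S.
    apply: ord_ge_sum => l; rewrite -[m.+1]add0n; apply: ord_ge_mul => //.
    exact: D_ord.
  rewrite -[LHS]/(_ * fps_mul _ _ _ + S _) hS ?hbe// addr0.
  by rewrite (@ord_ge_mul _ _ 0 m.+1) ?mulr0// hbe.
move/eqP; rewrite !mulf_eq0 pnatr_eq0 /=.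
by rewrite subr_eq0 => /orP[/eqP //|/eqP].
Qed.

(* Descending induction on [al i], for an [i] along which the linear part of
   [f h - f k] does not vanish: in degree [m.+1] only [al] itself contributes. *)
Let singular_step m k h : (forall k h, ord_ge m.+1 (G k h)) -> k != h ->
  f h (mindex0 d) = f k (mindex0 d) ->
  forall al, mdeg al = m.+1 -> G k h al = 0.
Proof.
move=> hG kh fhk; have [i hi] := f_neq kh.
move=> al hal; have [p] := ubnP (m.+1 - al i); elim: p al hal => // p IHp al hal hp.
have hi' al' : mdeg al' = m.+1 -> (al i < al' i)%N -> G k h al' = 0.
  move=> hal' lt; have le : (al' i <= m.+1)%N by rewrite -hal' /mdeg (bigD1 i)//= leq_addr.
  by apply: IHp => //; lia.
(* If [f l] shares the common value at the base point, the constant term of [W] vanishes; otherwise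
   [G k l] and [G l h] both fall under [regular_step]. *)
have hW l : fps_mul (W i k h l) (D k h l) al = 0.
  rewrite (fps_mul_ordr _ (@D_ord m.+1 k h l hG) hal) (D_lead k h l hG hal).
  have [fl|/eqP fl] := eqVneq (f l (mindex0 d)) (f h (mindex0 d)).
    rewrite -[W i k h l _]/(_ - _) !(@fps_mul_ordr _ _ 0 _ _ (mindex0 d)) ?mdeg0//.
    rewrite -[(f h - f l) _]/(_ - _) -[(f l - f k) _]/(_ - _) fl fhk !subrr.
    by rewrite mulr0 mul0r subrr mul0r.
  rewrite (@regular_step m k l hG)//; last by rewrite -fhk.
  rewrite (@regular_step m l h hG)//; last by move=> e; apply: fl.
  by rewrite mul0r mulr0 addr0 mulr0.
have := congr1 (fun a => a al) (G_eq i kh).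
rewrite -[X in _ = X]/(_ * fps_mul _ _ _ + _) (fps_mul_ordr _ (hG k h) hal).
have -> : (\sum_(l < n) fps_mul (W i k h l) (D k h l)) al = 0.
  apply: (big_ind (fun a : fpsC => a al = 0)) => // x y hx hy.
  by rewrite -[LHS]/(x al + y al) hx hy addr0.
rewrite addr0 -[(df i h - df i k) _]/(_ - _) /df /fps_deriv ffunE !mul1r.
set Li := f h _ - f k _ => E.
have Li0 : Li != 0 by rewrite subr_eq0.
have {E} : (al i)%:R * (Li * G k h al) = (b h - b k - 1) * (Li * G k h al).
  (* Index 0 carries the constant term of [f h - f k], which is 0. An index [e_j] with [j <> i]
     pairs with a coefficient of [G] of larger exponent at [i]. An index of degree at least 2 leaves
     for [G] a degree at most [m]. *)
  have hterm (be : multi_index d) : (forall j, be j <= al j)%N -> be != e_ i ->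
      (f h - f k) be * fps_deriv i (G k h) (mindex_sub al be) = 0.
    move=> hbe bei; have := mdeg_sub hbe; rewrite hal.
    case dbe: (mdeg be) => [|[|q]] dsub.
    - by rewrite (mdeg_eq0 dbe) -[(f h - f k) _]/(_ - _) fhk subrr mul0r.
    - have [j ej] := mdeg1P dbe; rewrite /fps_deriv [G k h _]hi' ?mulr0//.
        by rewrite mdeg_incr; lia.
      rewrite ej !ffunE eqxx; case: eqVneq => [ij|]; last by lia.
      by move: bei; rewrite ej ij eqxx.
    - by rewrite /fps_deriv [G k h _]hG ?mulr0// mdeg_incr; lia.
  rewrite -E; have [hi0|hi0] := posnP (al i).
    rewrite hi0 mul0r; apply/esym/fps_mul_eq0 => be hbe; apply: hterm => //.
    apply/eqP => ebe; have := hbe i; rewrite ebe !ffunE eqxx hi0.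
    by [].
  rewrite (@fps_mul_single _ _ _ _ _ (e_ i)).
  - rewrite mindex_incr_sub// -[(f h - f k) _]/Li !ffunE eqxx.
    by rewrite add0n subn1 prednK// mulrCA.
  - by move=> j; rewrite !ffunE add0n; case: eqVneq => [->|].
  - by move=> be hbe bei; apply: hterm.
move/eqP; rewrite -subr_eq0 -mulrBl !mulf_eq0 (negbTE Li0) /= => /orP[|/eqP//].
rewrite subr_eq0 => /eqP E.
(* The equality [al i = b h - b k - 1] would make [b h - b k] the positive integer [(al i).+1]. *)
exfalso; apply: (@b_nonres k h fhk (al i).+1) => //.
by rewrite -[RHS]/((al i).+1%:R) -natr1 E subrK.
Qed.

Lemma formal_uniqueness k h : F1 k h = F2 k h.
Proof.
suff H m : forall k h, ord_ge m (G k h).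
  apply/funext => al; apply/eqP; rewrite -subr_eq0 -[X in X == _]/(G k h al).
  by rewrite (H (mdeg al).+1).
elim: m => [|m IHm]; first by move=> k' h' al; rewrite ltn0.
move=> {}k {}h al; rewrite ltnS leq_eqVlt => /orP[/eqP hal|]; last exact: IHm.
case: m IHm hal => [_ /mdeg_eq0 ->|m IHm hal].
  by rewrite -[LHS]/(_ - _) F12_init subrr.
have [<-|kh] := eqVneq k h; first by rewrite /G F1_diag F2_diag subrr.
have [e|/eqP fhk] := eqVneq (f h (mindex0 d)) (f k (mindex0 d)).
  exact: singular_step hal.
exact: regular_step hal.
Qed.

End FormalUniqueness.

(** * Goursat's theorem *)

Section DyadicLoops.
Variable C : numClosedFieldType.
Implicit Types (f g : C -> C) (z u v s p : C) (N : nat).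

(** The mean of [f] over the left endpoints of [2 ^ N] equal pieces of the segment from [z] to
    [z + u]. The recursion by halves makes [dloopS] an exact identity. *)
Fixpoint dyavg f N z u : C :=
  if N is N'.+1 then (dyavg f N' z (u / 2) + dyavg f N' (z + u / 2) (u / 2)) / 2
  else f z.

(* The Riemann sum, over 2 ^ N left endpoints per side, of [f s ds] along the
   boundary of the parallelogram spanned by [u] and [v] at [z]. *)
Definition dloop f N z u v : C :=
  u * dyavg f N z u + v * dyavg f N (z + u) v
  - u * dyavg f N (z + v) u - v * dyavg f N z v.

Definition cell z u v s : Prop :=
  exists a b : C, [/\ 0 <= a <= 1, 0 <= b <= 1 & s = z + a * u + b * v].

(** The means are formed by halving only, so closure under midpoints suffices. It is applied to
    upper bounds of norms and to lower bounds of imaginary parts. *)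
Lemma dyavg_midpoint_closed (W : C -> Prop) f :
  (forall x y, W x -> W y -> W ((x + y) / 2)) ->
  forall N z u, (forall a : C, 0 <= a <= 1 -> W (f (z + a * u))) -> W (dyavg f N z u).
Proof.
move=> Wmid; elim=> [|N IHN] z u Wf /=.
  by rewrite -[z]addr0 -(mul0r u); apply: Wf; rewrite lexx ler01.
have half (a : C) : 0 <= a <= 1 -> 0 <= a / 2 <= 1.
  move=> /andP[a0 a1]; rewrite divr_ge0//= ler_pdivrMr// mul1r.
  by rewrite (le_trans a1)// ler1n.
apply: Wmid; apply: IHN => a a01.
  by have := Wf (a / 2) (half _ a01); rewrite mulrAC -mulrA.
have -> : z + u / 2 + a * (u / 2) = z + (2^-1 + a / 2) * u by ring.
apply: Wf; case/andP: a01 => a0 a1; rewrite addr_ge0 ?invr_ge0 ?divr_ge0//=.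
by rewrite [leRHS](splitr 1) lerD// ?div1r// ler_pdivrMr// mulVf.
Qed.

Lemma dyavg_lin f g (c : C) N z u :
  dyavg (fun s => f s - c * g s) N z u = dyavg f N z u - c * dyavg g N z u.
Proof. by elim: N z u => [|N IHN] z u //=; rewrite !IHN; ring. Qed.

Lemma norm_dyavg_le f N z u (M : C) :
  (forall a : C, 0 <= a <= 1 -> `|f (z + a * u)| <= M) -> `|dyavg f N z u| <= M.
Proof.
apply: (@dyavg_midpoint_closed (fun w => `|w| <= M)) => x y hx hy.
rewrite normrM normfV (ger0_norm (ler0n _ 2)) ler_pdivrMr//.
by rewrite mulr_natr mulr2n (le_trans (ler_normD _ _))// lerD.
Qed.

Lemma dloop_lin f g (c : C) N z u v :
  dloop (fun s => f s - c * g s) N z u v = dloop f N z u v - c * dloop g N z u v.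
Proof. by rewrite /dloop !dyavg_lin; ring. Qed.

(** The sums along the inner sides shared by two cells cancel exactly. *)
Lemma dloopS f N z u v : dloop f N.+1 z u v =
  dloop f N z (u / 2) (v / 2) + dloop f N (z + u / 2) (u / 2) (v / 2) +
  dloop f N (z + v / 2) (u / 2) (v / 2) +
  dloop f N (z + u / 2 + v / 2) (u / 2) (v / 2).
Proof.
rewrite /dloop /=.
have -> : z + u / 2 + v / 2 + u / 2 = z + u + v / 2 by field.
have -> : z + u / 2 + v / 2 + v / 2 = z + v + u / 2 by field.
have -> : z + v / 2 + u / 2 = z + u / 2 + v / 2 by ring.
have -> : z + u / 2 + u / 2 = z + u by field.
have -> : z + v / 2 + v / 2 = z + v by field.
by field.
Qed.

(** On a single cell the two pairs of opposite sides contribute [- b * u * v] and [b * u * v]: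
    affine functions have no discretization error. *)
Lemma dloop_affine (a b p : C) N z u v : dloop (fun s => a + b * (s - p)) N z u v = 0.
Proof.
elim: N z u v => [|N IHN] z u v; last by rewrite dloopS !IHN !addr0.
by rewrite /dloop /=; ring.
Qed.

Lemma norm_dloop_le f N z u v (M : C) : (forall s, cell z u v s -> `|f s| <= M) ->
  `|dloop f N z u v| <= 2 * (`|u| + `|v|) * M.
Proof.
move=> fM.
have z01 : 0 <= (0 : C) <= 1 by rewrite lexx ler01.
have o01 : 0 <= (1 : C) <= 1 by rewrite lexx ler01.
have b1 : `|u * dyavg f N z u| <= `|u| * M.
  rewrite normrM ler_wpM2l// norm_dyavg_le// => a a01; apply: fM.
  by exists a, 0; split=> //; ring.
have b2 : `|v * dyavg f N (z + u) v| <= `|v| * M.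
  rewrite normrM ler_wpM2l// norm_dyavg_le// => a a01; apply: fM.
  by exists 1, a; split=> //; ring.
have b3 : `|u * dyavg f N (z + v) u| <= `|u| * M.
  rewrite normrM ler_wpM2l// norm_dyavg_le// => a a01; apply: fM.
  by exists a, 1; split=> //; ring.
have b4 : `|v * dyavg f N z v| <= `|v| * M.
  rewrite normrM ler_wpM2l// norm_dyavg_le// => a a01; apply: fM.
  by exists 0, a; split=> //; ring.
have -> : 2 * (`|u| + `|v|) * M = `|u| * M + `|v| * M + `|u| * M + `|v| * M by ring.
rewrite (le_trans (ler_normB _ _))// lerD//.
rewrite (le_trans (ler_normB _ _))// lerD//.
by rewrite (le_trans (ler_normD _ _))// lerD.
Qed.

Lemma cell_dist z u v s p : cell z u v s -> cell z u v p -> `|s - p| <= `|u| + `|v|.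
Proof.
move=> [a [b [/andP[a0 a1] /andP[b0 b1] ->]]] [a' [b' [/andP[a0' a1'] /andP[b0' b1'] ->]]].
have -> : z + a * u + b * v - (z + a' * u + b' * v) = (a - a') * u + (b - b') * v by ring.
have H (c c' w : C) : 0 <= c -> c <= 1 -> 0 <= c' -> c' <= 1 -> `|(c - c') * w| <= `|w|.
  move=> c0 c1 c0' c1'; rewrite normrM ler_piMl// real_ler_norml ?realB ?ger0_real//.
  apply/andP; split; first by rewrite lerBrDl (le_trans _ c0)// subr_le0.
  by rewrite lerBlDl (le_trans c1)// lerDr.
by rewrite (le_trans (ler_normD _ _))// lerD// H.
Qed.

(** Subtracting the affine approximation at [p] does not change the loop, and the remainder is at
    most [e] times [|u| + |v|], which bounds the diameter of the cell. *)
Lemma dloop_local f p (l e : C) N z u v : cell z u v p ->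
  (forall s, cell z u v s -> `|f s - f p - l * (s - p)| <= e * `|s - p|) -> 0 <= e ->
  `|dloop f N z u v| <= 2 * e * (`|u| + `|v|) ^+ 2.
Proof.
move=> hp hf e0.
have -> : dloop f N z u v =
    dloop (fun s => f s - 1 * (f p + l * (s - p))) N z u v.
  by rewrite dloop_lin dloop_affine mulr0 subr0.
have -> : 2 * e * (`|u| + `|v|) ^+ 2 = 2 * (`|u| + `|v|) * (e * (`|u| + `|v|)) by ring.
apply: norm_dloop_le => s hs; rewrite mul1r opprD addrA (le_trans (hf _ hs))//.
by rewrite ler_wpM2l// (cell_dist hs hp).
Qed.

Lemma derivable_approx f p : derivable f p 1 ->
  forall e : C, 0 < e -> exists2 r : C, 0 < r & forall s, `|s - p| < r ->
    `|f s - f p - 'D_1 f p * (s - p)| <= e * `|s - p|.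
Proof.
move=> df e e0; have := df => /cvgrPdist_le/(_ e e0).
rewrite near_withinE => /nbhs_normP[r /= r0 hr]; exists r => // s sr.
have [->|sp] := eqVneq s p; first by rewrite !subrr mulr0 subrr normr0 mulr0.
have sp0 : s - p != 0 by rewrite subr_eq0.
have := hr (s - p); rewrite /= sub0r normrN => /(_ sr sp0).
rewrite -[_ *: 1]/(_ * 1) mulr1 subrK -[_ *: _]/(_ * _) => h.
have -> : f s - f p - 'D_1 f p * (s - p) =
    - ('D_1 f p - (s - p)^-1 * (f s - f p)) * (s - p).
  by field.
by rewrite normrM normrN ler_wpM2r.
Qed.

(** Stands for a zero contour integral: the Riemann sums tend to 0. *)
Definition dloop_vanishes f z u v : Prop := forall e : C, 0 < e ->
  exists N0, forall N, (N0 <= N)%N -> `|dloop f N z u v| <= e.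

(* All that the estimates below use of the completeness of [R[i]]. *)
Definition goursat_field : Prop :=
  (forall x e : C, 0 <= x -> 0 < e ->
     exists J, forall j, (J <= j)%N -> x * 2^-1 ^+ j < e) /\
  (forall f z u v, (forall s, cell z u v s -> derivable f s 1) ->
     dloop_vanishes f z u v).

End DyadicLoops.

Lemma nested_intervals (R : realType) (a h : nat -> R) :
  (forall j, a j <= a j.+1) -> (forall j, a j.+1 + h j.+1 <= a j + h j) ->
  (forall j, 0 <= h j) -> exists s, forall j, a j <= s <= a j + h j.
Proof.
move=> a_nd ah_ni h0.
have amono i j : (i <= j)%N -> a i <= a j.
  by move/subnKC <-; elim: (j - i)%N => [|m IHm]; rewrite ?addn0 ?addnS// (le_trans IHm).
have ahmono i j : (i <= j)%N -> a j + h j <= a i + h i.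
  move/subnKC <-; elim: (j - i)%N => [|m IHm]; rewrite ?addn0 ?addnS//.
  exact: le_trans IHm.
have aub i j : a i <= a j + h j.
  have [ij|/ltnW ji] := leqP i j; first by rewrite (le_trans (amono _ _ ij))// lerDl.
  by rewrite (le_trans _ (ahmono _ _ ji))// lerDl.
exists (sup (range a)) => j; apply/andP; split.
  apply: ub_le_sup; last by exists j.
  by exists (a 0%N + h 0%N) => _ [i _ <-].
by apply: ge_sup; [exists (a 0%N); exists 0%N | move=> _ [i _ <-]].
Qed.

(** [Q j a b] speaks of the square of side [2^-j] with lower left corner [(a, b)]. If [Q] failed on
    the unit square, it would fail on nested squares shrinking to some [(s, t)], against the local
    hypothesis. *)
Lemma dyadic_bisection (R : realType) (Q : nat -> R -> R -> Prop) :
  (forall j a b, let h := 2^-1 ^+ j.+1 in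
     Q j.+1 a b -> Q j.+1 (a + h) b -> Q j.+1 a (b + h) -> Q j.+1 (a + h) (b + h) ->
     Q j a b) ->
  (forall s t, 0 <= s <= 1 -> 0 <= t <= 1 -> exists J, forall j a b, (J <= j)%N ->
     a <= s <= a + 2^-1 ^+ j -> b <= t <= b + 2^-1 ^+ j -> Q j a b) ->
  Q 0%N 0 0.
Proof.
move=> Qsub Qloc; apply: contrapT => nQ0.
pose h j : R := 2^-1 ^+ j.
have hS j : h j.+1 + h j.+1 = h j by rewrite /h exprSr; field.
have h_ge0 j : 0 <= h j by rewrite exprn_ge0.
have hS_le j : h j.+1 <= h j by rewrite -(hS j) lerDl.
have step (x : nat * (R * R)) : exists y : R * R, ~ Q x.1 x.2.1 x.2.2 ->
    [/\ ~ Q x.1.+1 y.1 y.2, x.2.1 <= y.1, y.1 + h x.1.+1 <= x.2.1 + h x.1,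
        x.2.2 <= y.2 & y.2 + h x.1.+1 <= x.2.2 + h x.1].
  (* The pair [(0, 0)] is a dummy value for squares where [Q] holds. *)
  case: x => j [a b] /=; have [q|nq] := pselect (Q j a b); first by exists (0, 0).
  have sub (a' b' : R) : (a' = a) \/ (a' = a + h j.+1) ->
      (b' = b) \/ (b' = b + h j.+1) -> ~ Q j.+1 a' b' ->
      exists y : R * R, ~ Q j a b -> [/\ ~ Q j.+1 y.1 y.2, a <= y.1,
        y.1 + h j.+1 <= a + h j, b <= y.2 & y.2 + h j.+1 <= b + h j].
    move=> ha hb nq'; exists (a', b') => _ /=; split=> //.
    - by case: ha => ->; rewrite ?lerDl.
    - by case: ha => ->; rewrite -?addrA ?hS ?lerD2l.
    - by case: hb => ->; rewrite ?lerDl.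
    - by case: hb => ->; rewrite -?addrA ?hS ?lerD2l.
  have [q1|] := pselect (Q j.+1 a b); last by apply: sub; left.
  have [q2|] := pselect (Q j.+1 (a + h j.+1) b); last by apply: sub; [right|left].
  have [q3|] := pselect (Q j.+1 a (b + h j.+1)); last by apply: sub; [left|right].
  have [q4|] := pselect (Q j.+1 (a + h j.+1) (b + h j.+1)); last by apply: sub; right.
  by case: nq; apply: Qsub.
have [F HF] := choice step.
pose x := fix x j : R * R := if j is j'.+1 then F (j', x j') else (0, 0).
have xP j : ~ Q j (x j).1 (x j).2.
  by elim: j => //= j IHj; have [] := HF (j, x j) IHj.
have xS j := HF (j, x j) (xP j).
have [s hs] := @nested_intervals R (fun j => (x j).1) h
  (fun j => let: And5 _ p _ _ _ := xS j in p)
  (fun j => let: And5 _ _ p _ _ := xS j in p) h_ge0.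
have [t ht] := @nested_intervals R (fun j => (x j).2) h
  (fun j => let: And5 _ _ _ p _ := xS j in p)
  (fun j => let: And5 _ _ _ _ p := xS j in p) h_ge0.
have := hs 0%N; have := ht 0%N; rewrite /= add0r /h expr0 => t01 s01.
have [J HJ] := Qloc s t s01 t01.
by apply: (xP J); apply: HJ.
Qed.

Section Goursat.
Variable R : realType.
Local Notation C := (cplx R).
Implicit Types (f g : C -> C) (z u v s p : C) (N : nat).

(** Elements of [R[i]] comparable with 0 are real, which reduces the claim to the Archimedean
    property of [R]. *)
Lemma cplx_archi (x e : C) : 0 <= x -> 0 < e -> exists J, forall j, (J <= j)%N ->
  x * 2^-1 ^+ j < e.
Proof.
move=> x0 e0.
have [a ax] : exists a : R, x = real_complex R a.
  by apply/complex_realP; rewrite realE x0.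
have [c ce] : exists c : R, e = real_complex R c.
  by apply/complex_realP; rewrite realE ltW.
have c0 : 0 < c by move: e0; rewrite ce; simpc.
have a0 : 0 <= a by move: x0; rewrite ax; simpc.
exists (Num.bound (a / c)) => j hj.
have h1 : a / c < 2 ^+ j.
  have ac0 : 0 <= a / c by rewrite divr_ge0// ltW.
  apply: lt_le_trans (archi_boundP ac0) _.
  by rewrite -natrX ler_nat (leq_trans hj)// ltnW// ltn_expl.
have -> : x * 2^-1 ^+ j = real_complex R (a * 2^-1 ^+ j).
  by rewrite rmorphM rmorphXn/= fmorphV rmorph_nat ax.
rewrite ce ltcR exprVn ltr_pdivrMr ?exprn_gt0//.
by move: h1; rewrite ltr_pdivrMr// mulrC.
Qed.

(** The bound [e * (|u| + |v|) ^+ 2] is additive under division into four cells, so bisection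
    reduces it to small cells around a point, where [dloop_local] applies. *)
Theorem goursat f z u v : (forall s, cell z u v s -> derivable f s 1) ->
  dloop_vanishes f z u v.
Proof.
move=> df e e0.
pose P e z u v := exists N0, forall N, (N0 <= N)%N ->
  `|dloop f N z u v| <= e * (`|u| + `|v|) ^+ 2.
have Psub e' z' u' v' : P e' z' (u' / 2) (v' / 2) -> P e' (z' + u' / 2) (u' / 2) (v' / 2) ->
    P e' (z' + v' / 2) (u' / 2) (v' / 2) -> P e' (z' + u' / 2 + v' / 2) (u' / 2) (v' / 2) ->
    P e' z' u' v'.
  move=> [n1 h1] [n2 h2] [n3 h3] [n4 h4].
  exists (n1 + n2 + n3 + n4).+1 => -[//|N] hN; rewrite dloopS.
  have -> : e' * (`|u'| + `|v'|) ^+ 2 =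
    e' * (`|u' / 2| + `|v' / 2|) ^+ 2 + e' * (`|u' / 2| + `|v' / 2|) ^+ 2 +
    e' * (`|u' / 2| + `|v' / 2|) ^+ 2 + e' * (`|u' / 2| + `|v' / 2|) ^+ 2.
    rewrite !normrM !normfV (ger0_norm (ler0n _ 2)).
    by field.
  rewrite (le_trans (ler_normD _ _))// lerD//; last by apply: h4; lia.
  rewrite (le_trans (ler_normD _ _))// lerD//; last by apply: h3; lia.
  rewrite (le_trans (ler_normD _ _))// lerD//; last by apply: h2; lia.
  by apply: h1; lia.
pose S := `|u| + `|v|.
have S0 : 0 <= S by rewrite addr_ge0.
(* The summand 1 keeps the denominator positive when [u = v = 0]. *)
pose e1 := e / (S ^+ 2 + 1).
have e1_gt0 : 0 < e1 by rewrite divr_gt0// ltr_wpDl// exprn_ge0.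
suff [N0 hN0] : P e1 z u v.
  exists N0 => N /hN0 /le_trans; apply.
  by rewrite /e1 mulrAC ler_pdivrMr ?ltr_wpDl ?exprn_ge0// (ler_wpM2l (ltW e0))// lerDl.
pose Q j (a b : R) := P e1 (z + real_complex R a * u + real_complex R b * v)
  (u * 2^-1 ^+ j) (v * 2^-1 ^+ j).
suff: Q 0%N 0 0 by rewrite /Q !expr0 !mulr1 !mul0r !addr0.
have rcX j : real_complex R (2^-1 ^+ j) = 2^-1 ^+ j :> C.
  by rewrite rmorphXn/= fmorphV rmorph_nat.
have addu (a b h : C) : z + (a + h / 2) * u + b * v = z + a * u + b * v + u * h / 2.
  by ring.
have addv (a b h : C) : z + a * u + (b + h / 2) * v = z + a * u + b * v + v * h / 2.
  by ring.
apply: dyadic_bisection => [j a b h|s t s01 t01].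
  rewrite /Q /h !rmorphD /= !rcX !(exprSr 2^-1 j) !mulrA.
  move=> q1 q2 q3 q4; apply: Psub => //.
  - by rewrite -addu.
  - by rewrite -addv.
  - by rewrite -addu -addv.
set p := z + real_complex R s * u + real_complex R t * v.
have fp : derivable f p 1.
  apply: df; exists (real_complex R s), (real_complex R t).
  by split=> //; rewrite -(rmorph0 (real_complex R)) -(rmorph1 (real_complex R)) !lecR.
(* The half absorbs the factor 2 of [dloop_local]. *)
have [|r r0 hr] := derivable_approx fp (e := e1 / 2); first by rewrite divr_gt0.
have [J HJ] := cplx_archi S0 r0.
exists J => j a b Jj has hbt; exists 0%N => N _.
have -> : e1 = 2 * (e1 / 2) by field.
have uv : `|u * 2^-1 ^+ j| + `|v * 2^-1 ^+ j| = S * 2^-1 ^+ j.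
  have h0 : 0 <= 2^-1 ^+ j :> C by rewrite exprn_ge0.
  by rewrite !normrM (ger0_norm h0) -mulrDl.
have loc (c w : R) : c <= w <= c + 2^-1 ^+ j ->
    exists2 q : C, 0 <= q <= 1 & real_complex R w = real_complex R c + q * 2^-1 ^+ j.
  move=> /andP[cw wc]; exists (real_complex R ((w - c) * 2 ^+ j)).
    rewrite -(rmorph0 (real_complex R)) -(rmorph1 (real_complex R)) !lecR.
    have h1 : (1 : R) = 2^-1 ^+ j * 2 ^+ j by rewrite -exprMn mulVf// expr1n.
    by rewrite mulr_ge0 ?subr_ge0//= [leRHS]h1 ler_wpM2r// lerBlDl.
  rewrite -rcX -rmorphM -rmorphD; congr (real_complex R _).
  by rewrite -mulrA -exprMn mulfV// expr1n mulr1 addrC subrK.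
have cp : cell (z + real_complex R a * u + real_complex R b * v)
    (u * 2^-1 ^+ j) (v * 2^-1 ^+ j) p.
  have [q q01 eq] := loc _ _ has; have [q' q'01 eq'] := loc _ _ hbt.
  by exists q, q'; split=> //; rewrite /p eq eq'; ring.
apply: (@dloop_local (cplx R) f p ('D_1 f p) (e1 / 2) N _ _ _ cp _ _);
  last by rewrite ltW// divr_gt0.
move=> w hw; apply: hr; apply: le_lt_trans (cell_dist hw cp) _.
by rewrite uv HJ.
Qed.

Lemma cplx_goursat_field : goursat_field C.
Proof. by split; [exact: cplx_archi|exact: goursat]. Qed.

End Goursat.

(** * Vanishing loops with an exceptional corner *)

Section CauchyBound.
Variable C : numClosedFieldType.
Hypothesis CG : goursat_field C.
Implicit Types (f g : C -> C) (z u v s p a : C) (N : nat).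

Lemma derivable_subr (c p : C) : derivable (fun s : C => s - c) p 1.
Proof. exact: derivableB. Qed.

(* Bisect at the corner [z]: three of the four cells avoid [z], and the perimeter
   of the fourth one is halved. *)
Lemma goursat_corner f z u v r (B : C) : 0 < r ->
  (forall s, `|s - z| < r -> `|f s| <= B) ->
  (forall s, cell z u v s -> s != z -> derivable f s 1) ->
  (forall x y : C, 0 <= x -> 0 <= y -> x * u + y * v = 0 -> x = 0 /\ y = 0) ->
  dloop_vanishes f z u v.
Proof.
move=> r0 fB df indep.
have B0 : 0 <= B by apply: le_trans (fB z _); rewrite ?subrr ?normr0.
(* Here [e] bounds the cell left at the corner after [j] halvings, and [e'] all the cells that avoid
   the corner. *)
suff H j e : 2 * (`|u| + `|v|) * 2^-1 ^+ j * B <= e ->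
    (`|u| + `|v|) * 2^-1 ^+ j < r ->
    forall e', 0 < e' -> exists N0, forall N, (N0 <= N)%N ->
      `|dloop f N z u v| <= e + e'.
  move=> e e0; have S0 : 0 <= `|u| + `|v| by rewrite addr_ge0.
  have [J1 HJ1] := CG.1 _ _ S0 r0.
  have [J2 HJ2] : exists J, forall j, (J <= j)%N ->
      2 * (`|u| + `|v|) * B * 2^-1 ^+ j < e / 2.
    by apply: CG.1; rewrite ?divr_gt0// !mulr_ge0.
  rewrite [e]splitr; apply: (H (J1 + J2)%N); last by rewrite divr_gt0.
  - by rewrite mulrAC ltW// HJ2// leq_addl.
  - by rewrite HJ1// leq_addr.
elim: j u v e df indep => [|j IHj] u v e df indep.
  rewrite expr0 !mulr1 => he hr e' e'0; exists 0%N => N _.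
  apply: le_trans (le_trans he _); last by rewrite lerDl ltW.
  apply: norm_dloop_le => s hs; apply: fB; apply: le_lt_trans hr.
  apply: (cell_dist hs); exists 0, 0; rewrite lexx ler01; split=> //.
  by rewrite !mul0r !addr0.
move=> he hr e' e'0.
have half (a b : C) : 0 <= a <= 1 -> 0 <= b -> b <= 1 -> 0 <= (b + a) / 2 <= 1.
  move=> /andP[a0 a1] b0 b1; rewrite divr_ge0 ?addr_ge0//=.
  by rewrite ler_pdivrMr// mul1r [leRHS](_ : 2 = 1 + 1) ?lerD.
have sub (x y : C) s : 0 <= x -> x <= 1 -> 0 <= y -> y <= 1 ->
    cell (z + x * (u / 2) + y * (v / 2)) (u / 2) (v / 2) s -> cell z u v s.
  move=> x0 x1 y0 y1 [a [b [a01 b01 ->]]].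
  exists ((x + a) / 2), ((y + b) / 2); split; [exact: half|exact: half|by field].
(* Such a point has coordinates [(x + a) / 2] and [(y + b) / 2], nonnegative and not both 0;
   independence keeps it off the corner. *)
have away (x y : C) s : 0 <= x -> 0 <= y -> (x != 0) || (y != 0) ->
    cell (z + x * (u / 2) + y * (v / 2)) (u / 2) (v / 2) s -> s != z.
  move=> x0 y0 xy [a [b [/andP[a0 _] /andP[b0 _] ->]]]; apply/eqP => E.
  have [] := indep ((x + a) / 2) ((y + b) / 2).
  - by rewrite divr_ge0 ?addr_ge0.
  - by rewrite divr_ge0 ?addr_ge0.
  - apply: (@addrI _ z); rewrite addr0 -[RHS]E; by field.
  move=> /eqP; rewrite mulf_eq0 invr_eq0 pnatr_eq0 orbF paddr_eq0// => /andP[x00 _].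
  move=> /eqP; rewrite mulf_eq0 invr_eq0 pnatr_eq0 orbF paddr_eq0// => /andP[y00 _].
  by rewrite x00 y00 in xy.
have good (x y : C) : 0 <= x -> x <= 1 -> 0 <= y -> y <= 1 -> (x != 0) || (y != 0) ->
    dloop_vanishes f (z + x * (u / 2) + y * (v / 2)) (u / 2) (v / 2).
  move=> x0 x1 y0 y1 xy; apply: CG.2 => s hs; apply: df; first exact: sub hs.
  exact: away hs.
have sz : z = z + 0 * (u / 2) + 0 * (v / 2) by rewrite !mul0r !addr0.
have e4 : 0 < e' / 4 by rewrite divr_gt0.
have [||||N1 h1] := IHj (u / 2) (v / 2) e _ _ _ _ _ e4.
- by move=> s hs; apply: df; apply: (sub 0 0); rewrite // -?sz.
- move=> x y x0 y0 h; have [] := indep (x / 2) (y / 2); rewrite ?divr_ge0//.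
    by rewrite -h; field.
  by move=> /eqP + /eqP; rewrite !mulf_eq0 invr_eq0 pnatr_eq0 !orbF => /eqP + /eqP.
- move: he; rewrite !normrM !normfV (ger0_norm (ler0n _ 2)) exprSr.
  by congr (_ <= _); field.
- move: hr; rewrite !normrM !normfV (ger0_norm (ler0n _ 2)) exprSr.
  by congr (_ < _); field.
have [|||||N2 h2] := good 1 0 _ _ _ _ _ _ e4; rewrite ?ler01 ?lexx ?oner_eq0//.
have [|||||N3 h3] := good 0 1 _ _ _ _ _ _ e4; rewrite ?ler01 ?lexx ?oner_eq0 ?orbT//.
have [|||||N4 h4] := good 1 1 _ _ _ _ _ _ e4; rewrite ?ler01 ?lexx ?oner_eq0//.
move: h2 h3 h4; rewrite !mul1r !mul0r !addr0 => h2 h3 h4.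
exists (N1 + N2 + N3 + N4).+1 => -[//|N] hN; rewrite dloopS.
have -> : e + e' = e + e' / 4 + e' / 4 + e' / 4 + e' / 4 by field.
rewrite (le_trans (ler_normD _ _))// lerD//; last by apply: h4; lia.
rewrite (le_trans (ler_normD _ _))// lerD//; last by apply: h3; lia.
rewrite (le_trans (ler_normD _ _))// lerD//; last by apply: h2; lia.
by apply: h1; lia.
Qed.

End CauchyBound.

(** * The maximum modulus principle *)

Section CauchyEstimate.
Variable C : numClosedFieldType.
Hypothesis CG : goursat_field C.
Implicit Types (f g : C -> C) (z u v s p a w : C) (N : nat).
Local Notation i := ('i : C).

Lemma derivable_diff_quotient f (c d p : C) : derivable f p 1 -> p != d ->
  derivable (fun s => (f s - c) / (s - d)) p 1.
Proof.
move=> df pd; apply: (@derivableM C C (fun s => f s - c) (fun s => (s - d)^-1)).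
  exact: (derivableB df (derivable_cst c p 1)).
apply: (@derivableV C C (fun s => s - d)); first by rewrite subr_eq0.
exact: derivable_subr.
Qed.

Lemma diff_quotient_bounded f p : derivable f p 1 ->
  exists2 r : C, 0 < r & exists B : C, forall s, `|s - p| < r ->
    `|(f s - f p) / (s - p)| <= B.
Proof.
move=> df; have [r r0 hr] := derivable_approx df (@ltr01 C).
exists r => //; exists (1 + `|'D_1 f p|) => s sr.
(* At [s = p] the quotient is 0, by the convention [0^-1 = 0]. *)
have [->|sp] := eqVneq s p.
  by rewrite subrr mul0r normr0 addr_ge0.
have sp0 : 0 < `|s - p| by rewrite normr_gt0 subr_eq0.
rewrite normrM normfV ler_pdivrMr// mulrDl -normrM.
by rewrite -[X in `|X| <= _](subrK ('D_1 f p * (s - p))) (le_trans (ler_normD _ _))// lerD// hr.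
Qed.

(* The integral of [g s ds] over the outer boundary of the union of the cells
   spanned at [a] by [w, i w], [i w, - w], [- w, - i w] and [- i w, w]. *)
Definition dsquare g N a w : C :=
  \sum_(k < 4) (i ^+ k.+1 * w * dyavg g N (a + i ^+ k * w) (i ^+ k.+1 * w)
                - i ^+ k * w * dyavg g N (a + i ^+ k.+1 * w) (i ^+ k * w)).

(** Each spoke from [a] to [a + i ^+ k * w] is run through in both directions and cancels;
    [i ^+ 4 = i ^+ 0] closes the cycle. *)
Lemma dsquareE g N a w :
  dsquare g N a w = \sum_(k < 4) dloop g N a (i ^+ k * w) (i ^+ k.+1 * w).
Proof.
rewrite /dsquare /dloop !big_ord_recr !big_ord0 /= !add0r.
have -> : i ^+ 4 = i ^+ 0 by rewrite expr0 (exprM _ 2 2) sqrCi sqrrN expr1n.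
ring.
Qed.

Lemma dsquare_lin f g (c : C) N a w :
  dsquare (fun s => f s - c * g s) N a w = dsquare f N a w - c * dsquare g N a w.
Proof.
rewrite /dsquare mulr_sumr -sumrB; apply: eq_bigr => k _.
by rewrite !dyavg_lin; ring.
Qed.

(** The fraction is [i / (1 + i t)], the integrand [ds / (s - a)] along the side [s = a + 1 + i t];
    its imaginary part is [1 / (1 + t ^+ 2)]. *)
Lemma Im_corner (t : C) : t \is Num.real -> t ^+ 2 <= 1 ->
  2^-1 <= 'Im ((i + t) / (1 + t ^+ 2)).
Proof.
move=> tr t1; have t20 : 0 <= t ^+ 2 by rewrite real_exprn_even_ge0.
have d0 : 0 < 1 + t ^+ 2 by rewrite ltr_pwDl.
have -> : (i + t) / (1 + t ^+ 2) = t / (1 + t ^+ 2) + i * (1 + t ^+ 2)^-1.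
  by rewrite addrC mulrDl.
have r1 : t / (1 + t ^+ 2) \is Num.real by rewrite realM// ger0_real// invr_ge0 ltW.
have r2 : (1 + t ^+ 2)^-1 \is Num.real by rewrite ger0_real// invr_ge0 ltW.
rewrite Im_rect// lef_pV2 ?posrE ?ltr0n//.
by rewrite [leRHS](_ : 2 = 1 + 1)// lerD2l.
Qed.

Lemma corner_neq0 (t : C) : 0 <= t -> (1 + i * t != 0) /\ (i + t != 0).
Proof.
move=> t0; have tr : t \is Num.real by rewrite ger0_real.
have nz (x y : C) : x \is Num.real -> y \is Num.real -> (x != 0) || (y != 0) -> x + i * y != 0.
  move=> xr yr; apply: contraTneq => e.
  have := congr1 (fun z => 'Re z) e; have := congr1 (fun z => 'Im z) e.
  by rewrite Im_rect// Re_rect// !raddf0 => -> ->; rewrite eqxx.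
split; first by rewrite nz// oner_eq0.
by rewrite addrC -[X in _ + X]mulr1 nz// oner_eq0 orbT.
Qed.

Lemma norm_corner_ge1 (t : C) : 0 <= t -> 1 <= `|1 + i * t| /\ 1 <= `|i + t|.
Proof.
move=> t0; have tr : t \is Num.real by rewrite ger0_real.
have h : 1 <= `|1 + i * t|.
  rewrite -(@ler_pXn2r _ 2)// ?nnegrE// expr1n normC2_rect// expr1n lerDl.
  exact: exprn_ge0.
split=> //; have -> : i + t = i * (1 + i * - t).
  by rewrite mulrDr mulr1 mulrA -expr2 sqrCi mulN1r opprK.
rewrite normrM normCi mul1r -(@ler_pXn2r _ 2)// ?nnegrE// expr1n.
by rewrite normC2_rect ?realN// expr1n sqrrN lerDl exprn_ge0.
Qed.

Lemma norm_iXM k w : `|i ^+ k * w| = `|w|.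
Proof. by rewrite normrM normrX normCi expr1n mul1r. Qed.

Lemma ge_mid (m x y : C) : m <= x -> m <= y -> m <= (x + y) / 2.
Proof. by move=> mx my; rewrite ler_pdivlMr// mulr_natr mulr2n lerD. Qed.

(** Places the boundary of the square in the annulus on which [cauchy_bound] controls [f]. *)
Lemma norm_corner_bounds (t w : C) k : 0 <= t <= 1 ->
  `|w| <= `|i ^+ k * w + t * (i ^+ k.+1 * w)| <= 2 * `|w| /\
  `|w| <= `|i ^+ k.+1 * w + t * (i ^+ k * w)| <= 2 * `|w|.
Proof.
move=> /andP[t0 t1]; have [h1 h2] := norm_corner_ge1 t0.
have tw : `|t| <= 1 by rewrite ger0_norm.
split; apply/andP; split.
- have -> : i ^+ k * w + t * (i ^+ k.+1 * w) = (1 + i * t) * (i ^+ k * w).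
    by rewrite exprS; ring.
  by rewrite normrM norm_iXM ler_peMl.
- rewrite (le_trans (ler_normD _ _))// norm_iXM normrM norm_iXM mulr2n mulrDl mul1r.
  by rewrite lerD2l ler_piMl.
- have -> : i ^+ k.+1 * w + t * (i ^+ k * w) = (i + t) * (i ^+ k * w).
    by rewrite exprS; ring.
  by rewrite normrM norm_iXM ler_peMl.
- rewrite (le_trans (ler_normD _ _))// norm_iXM normrM norm_iXM mulr2n mulrDl mul1r.
  by rewrite lerD2l ler_piMl.
Qed.

(** The boundary consists of eight segments of length [|w|]. *)
Lemma norm_dsquare_le f N a w (M : C) :
  (forall s, `|w| <= `|s - a| <= 2 * `|w| -> `|w| * `|f s| <= M) ->
  `|dsquare f N a w| <= 8 * M.
Proof.
move=> fM; rewrite (le_trans (ler_norm_sum _ _ _))//.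
have -> : 8 * M = \sum_(k < 4) (M + M).
  by rewrite !big_ord_recr big_ord0 /=; ring.
have mid (c : C) : forall x y : C, `|c| * `|x| <= M -> `|c| * `|y| <= M ->
    `|c| * `|(x + y) / 2| <= M.
  move=> x y; rewrite -!normrM => hx hy; rewrite mulrA mulrDr.
  rewrite normrM normfV (ger0_norm (ler0n _ 2)) ler_pdivrMr//.
  by rewrite mulr_natr mulr2n (le_trans (ler_normD _ _))// lerD.
apply: ler_sum => k _; rewrite (le_trans (ler_normB _ _))// lerD// normrM.
  apply: (@dyavg_midpoint_closed C (fun x => `|i ^+ k.+1 * w| * `|x| <= M)).
    exact: mid.
  move=> t t01; rewrite norm_iXM; apply: fM; rewrite addrC addrA addKr.
  by have [] := norm_corner_bounds w k t01.
apply: (@dyavg_midpoint_closed C (fun x => `|i ^+ k * w| * `|x| <= M)).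
  exact: mid.
move=> t t01; rewrite norm_iXM; apply: fM; rewrite addrC addrA addKr.
by have [] := norm_corner_bounds w k t01.
Qed.

(** A lower bound in place of the exact integral [2 pi i]: each of the eight segments contributes at
    least 1/2. *)
Lemma Im_dsquare_inv N a w : w != 0 -> 4 <= 'Im (dsquare (fun s => (s - a)^-1) N a w).
Proof.
move=> w0; rewrite /dsquare raddf_sum.
have -> : (4 : C) = \sum_(k < 4) 1 by rewrite sumr_const card_ord.
apply: ler_sum => k _; rewrite raddfB /= -raddfN -mulNr.
have mid (c : C) : forall x y : C, 2^-1 <= 'Im (c * x) -> 2^-1 <= 'Im (c * y) ->
    2^-1 <= 'Im (c * ((x + y) / 2)).
  move=> x y hx hy; have -> : c * ((x + y) / 2) = (c * x + c * y) / 2 by ring.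
  by rewrite ImMr ?rpredV ?realn// raddfD /=; apply: ge_mid.
have ik : i ^+ k * w != 0 by rewrite mulf_neq0// expf_neq0// neq0Ci.
have den (t : C) : t \is Num.real -> 1 + t ^+ 2 != 0.
  by move=> tr; rewrite lt0r_neq0// ltr_pwDl// real_exprn_even_ge0.
have ii : i * i = -1 by rewrite -expr2 sqrCi.
rewrite [leLHS](splitr 1) !div1r lerD//.
  apply: (@dyavg_midpoint_closed C (fun x => 2^-1 <= 'Im (i ^+ k.+1 * w * x))).
    exact: mid.
  move=> t /andP[t0 t1]; have [nz1 nz2] := corner_neq0 t0.
  have -> : a + i ^+ k * w + t * (i ^+ k.+1 * w) - a = (1 + i * t) * (i ^+ k * w).
    by rewrite exprS; ring.
  have -> : i ^+ k.+1 * w / ((1 + i * t) * (i ^+ k * w)) = (i + t) / (1 + t ^+ 2).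
    have nzd : (1 + i * t) * (i ^+ k * w) != 0 by rewrite mulf_neq0.
    apply/eqP; rewrite eqr_div ?den ?ger0_real//; apply/eqP; rewrite exprS.
    transitivity (i * i ^+ k * w * (1 + t ^+ 2) + t * (i ^+ k * w) * (1 + i * i)).
      by rewrite ii subrr mulr0 addr0.
    by ring.
  by apply: Im_corner; rewrite ?ger0_real// exprn_ile1.
apply: (@dyavg_midpoint_closed C (fun x => 2^-1 <= 'Im (- (i ^+ k * w) * x))).
  exact: mid.
move=> t /andP[t0 t1]; have [nz1 nz2] := corner_neq0 t0.
have -> : a + i ^+ k.+1 * w + t * (i ^+ k * w) - a = (i + t) * (i ^+ k * w).
  by rewrite exprS; ring.
have -> : - (i ^+ k * w) / ((i + t) * (i ^+ k * w)) = (i + - t) / (1 + (- t) ^+ 2).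
  have nzd : (i + t) * (i ^+ k * w) != 0 by rewrite mulf_neq0.
  apply/eqP; rewrite eqr_div ?den ?realN ?ger0_real//; apply/eqP.
  transitivity (- (i ^+ k * w) * (1 + (- t) ^+ 2) + i ^+ k * w * (1 + i * i)).
    by rewrite ii subrr mulr0 addr0.
  by ring.
by apply: Im_corner; rewrite ?realN ?ger0_real// sqrrN exprn_ile1.
Qed.

(* The quotient [(f s - f a) / (s - a)] has vanishing loops, while the loops of
   [(s - a)^-1] have imaginary part at least 4. *)
Lemma cauchy_bound f a r (M : C) : 0 < r ->
  (forall s, `|s - a| <= 2 * r -> derivable f s 1) ->
  (forall s, r <= `|s - a| <= 2 * r -> `|f s| <= M) -> `|f a| <= 2 * M.
Proof.
move=> r0 df fM; pose g s := (f s - f a) / (s - a).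
have rn : `|r| = r by rewrite ger0_norm// ltW.
have fda : derivable f a 1 by apply: df; rewrite subrr normr0 mulr_ge0// ltW.
have [r1 r10 [B hB]] := diff_quotient_bounded fda.
have van (k : 'I_4) : dloop_vanishes g a (i ^+ k * r) (i ^+ k.+1 * r).
  apply: (goursat_corner CG r10 hB) => [s hs sa|x y x0 y0 E].
    suff dfs : derivable f s 1 by exact: (derivable_diff_quotient dfs sa).
    apply: df.
    have : cell a (i ^+ k * r) (i ^+ k.+1 * r) a.
      by exists 0, 0; rewrite lexx ler01; split=> //; rewrite !mul0r !addr0.
    by move=> /(cell_dist hs) /le_trans; apply; rewrite !norm_iXM rn mulr2n mulrDl mul1r.
  have : x + i * y = 0.
    apply: (@mulIf _ (i ^+ k * r)); first by rewrite mulf_neq0 ?expf_neq0 ?neq0Ci ?gt_eqF.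
    by rewrite mul0r -[RHS]E exprS; ring.
  have xr : x \is Num.real by rewrite ger0_real.
  have yr : y \is Num.real by rewrite ger0_real.
  move=> e; have := congr1 (fun z => 'Re z) e; have := congr1 (fun z => 'Im z) e.
  by rewrite Im_rect// Re_rect// !raddf0.
suff H e : 0 < e -> 4 * `|f a| <= 8 * M + e.
  rewrite -(@ler_pM2l _ 4)// mulrA -natrM.
  apply/ler_addgt0Pr => e e0; exact: H.
move=> e0; have e4 : 0 < e / 4 by rewrite divr_gt0.
have [N0 hN0] : exists N0 : 'I_4 -> nat, forall k N, (N0 k <= N)%N ->
    `|dloop g N a (i ^+ k * r) (i ^+ k.+1 * r)| <= e / 4.
  have [N0 hN0] := choice (fun k => van k _ e4).
  by exists N0.
pose N := (\sum_k N0 k)%N.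
have gN : `|dsquare g N a r| <= e.
  rewrite dsquareE (le_trans (ler_norm_sum _ _ _))//.
  have -> : e = \sum_(k < 4) (e / 4) by rewrite sumr_const card_ord -[RHS]mulr_natr divfK.
  by apply: ler_sum => k _; apply: hN0; rewrite /N (bigD1 k)//= leq_addr.
have gE : dsquare g N a r =
    dsquare (fun s => f s / (s - a)) N a r - f a * dsquare (fun s => (s - a)^-1) N a r.
  by rewrite -dsquare_lin; congr dsquare; apply/funext => s; rewrite /g mulrBl.
have fN : `|dsquare (fun s => f s / (s - a)) N a r| <= 8 * M.
  apply: norm_dsquare_le; rewrite rn => s /andP[rs sr].
  have s0 : 0 < `|s - a| by apply: lt_le_trans rs.
  rewrite normrM normfV mulrA ler_pdivrMr// mulrC.
  have fsM : `|f s| <= M by apply: fM; rewrite rs.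
  exact: ler_pM (ltW r0) fsM rs.
have KN : 4 <= `|dsquare (fun s => (s - a)^-1) N a r|.
  have r_neq0 : r != 0 by rewrite gt_eqF.
  apply: le_trans (Im_dsquare_inv N a r_neq0) _.
  set K := dsquare _ _ _ _; have -> : 'Im K = 'Re (i * - K) by rewrite ReMil raddfN opprK.
  by rewrite (le_trans (leif_Re_Creal _).1)// normrM normCi mul1r normrN.
apply: (@le_trans _ _ (`|f a * dsquare (fun s => (s - a)^-1) N a r|)).
  by rewrite normrM mulrC ler_wpM2l.
have -> : f a * dsquare (fun s => (s - a)^-1) N a r =
   dsquare (fun s => f s / (s - a)) N a r - dsquare g N a r by rewrite gE opprB addrC subrK.
by rewrite (le_trans (ler_normB _ _))// lerD.
Qed.

End CauchyEstimate.

(** * Exceptional points in the maximum modulus principle *)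

Section RemovableSingularities.
Variable C : numClosedFieldType.
Hypothesis CG : goursat_field C.
Implicit Types (f g u : C -> C) (s t p a e : C).

(** The order of [C] is only partial, but positive elements are real and therefore comparable. *)
Lemma common_radius (r r' : C) : 0 < r -> 0 < r' ->
  exists2 q : C, 0 < q & q <= r /\ q <= r'.
Proof.
move=> r0 r0'; have [rr|/ltW rr] := real_leP (gtr0_real r0) (gtr0_real r0').
  by exists r.
by exists r'.
Qed.

(** Otherwise [(x / y) ^+ N] grows at least linearly by Bernoulli's inequality; taking [N = 2 ^ J]
    contradicts the Archimedean clause of [goursat_field]. *)
Lemma expr_bound_le (x y d K : C) : 0 <= x -> 0 <= y -> 0 < d ->
  (forall N, x ^+ N * d <= K * y ^+ N) -> x <= y.
Proof.
move=> x0 y0 d0 H; have [//|yx] := real_leP (ger0_real x0) (ger0_real y0).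
have [y00|yn0] := eqVneq y 0.
  have := H 1%N; rewrite y00 expr0n mulr0 expr1 pmulr_lle0//.
  by move=> /(lt_le_trans yx); rewrite y00 ltxx.
have yp : 0 < y by rewrite lt_def yn0.
have K0 : 0 <= K by have := H 0%N; rewrite !expr0 mulr1 mul1r; apply/le_trans/ltW.
pose t := x / y - 1; have t0 : 0 < t by rewrite subr_gt0 ltr_pdivlMr// mul1r.
have bern N : 1 + N%:R * t <= (x / y) ^+ N.
  elim: N => [|N IHN]; first by rewrite mul0r addr0 expr0.
  have xy1 : x / y = 1 + t by rewrite addrC subrK.
  rewrite exprSr; apply: le_trans (ler_wpM2r _ IHN); last by rewrite divr_ge0.
  rewrite xy1 -natr1 -subr_ge0.
  have -> : (1 + N%:R * t) * (1 + t) - (1 + (N%:R + 1) * t) = N%:R * t ^+ 2 by ring.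
  by rewrite mulr_ge0// exprn_ge0// ltW.
have H' N : d * (N%:R * t) <= K.
  have h1 : (x / y) ^+ N * d <= K.
    by rewrite expr_div_n mulrAC ler_pdivrMr ?exprn_gt0//; exact: H.
  apply: le_trans h1; rewrite mulrC ler_wpM2r ?(ltW d0)//.
  by apply: le_trans (bern N); rewrite lerDr.
have dt : 0 < d * t by rewrite mulr_gt0.
have Kdt : 0 <= K / (d * t) by rewrite divr_ge0// ltW.
have [J HJ] := CG.1 _ _ Kdt (@ltr01 C).
have := HJ J (leqnn J); rewrite exprVn ltr_pdivrMr ?exprn_gt0// mul1r ltr_pdivrMr//.
rewrite -natrX; have := H' (2 ^ J)%N; rewrite mulrCA => h1 h2.
by have := le_lt_trans h1 h2; rewrite ltxx.
Qed.

(** The difference quotient at [e] is [f (h + e) * h], which tends to 0. The value of [f] at [e] is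
    multiplied by 0. *)
Lemma removable_sqr f e r (B : C) : 0 < r ->
  (forall s, s != e -> `|s - e| < r -> `|f s| <= B) ->
  derivable (fun s => f s * (s - e) ^+ 2) e 1.
Proof.
move=> r0 fB; apply/cvg_ex; exists 0; apply/cvgrPdist_le => eps eps0.
have B1 : 0 < `|B| + 1 by rewrite ltr_wpDl.
rewrite near_withinE; apply/nbhs_normP.
have m0 : 0 < eps / (`|B| + 1) by rewrite divr_gt0.
have [q q0 [qr qe]] := common_radius r0 m0.
exists q => //= h hq' h0; rewrite sub0r normrN.
have hq : `|h| < q by move: hq'; rewrite /ball_ /= sub0r normrN.
have hr := lt_le_trans hq qr; have he := lt_le_trans hq qe.
rewrite -[_ *: 1]/(_ * 1) -[_ *: _]/(_ * _) mulr1 subrr expr0n mulr0 subr0 addrK.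
have -> : h^-1 * (f (h + e) * h ^+ 2) = f (h + e) * h by field.
have fhB : `|f (h + e)| <= `|B|.
  have fhB : `|f (h + e)| <= B.
    apply: fB; last by rewrite addrK.
    by rewrite -subr_eq0 addrK.
  by rewrite (ger0_norm (le_trans (normr_ge0 _) fhB)).
rewrite normrM; apply: (le_trans (ler_pM _ _ fhB (ltW he))) => //.
by rewrite mulrCA ler_piMr ?(ltW eps0)// ler_pdivrMr// mul1r lerDl.
Qed.

Lemma derivable_exprM f g p N : derivable f p 1 -> derivable g p 1 ->
  derivable (fun s => f s ^+ N * g s) p 1.
Proof.
move=> df dg; have -> : (fun s => f s ^+ N * g s) = f ^+ N * g.
  by apply/funext => s; rewrite -[RHS]/((f ^+ N) s * g s) exprfctE.
by apply: derivableM; [apply: derivableX; exact: df|exact: dg].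
Qed.

Lemma derivable_sqr_subr e p : derivable (fun s : C => (s - e) ^+ 2) p 1.
Proof.
have -> : (fun s : C => (s - e) ^+ 2) = (fun s => s - e) ^+ 2.
  by apply/funext => s; rewrite exprfctE.
by apply: derivableX; apply: derivable_subr.
Qed.

Definition loc_bounded f e : Prop := exists2 r : C, 0 < r &
  exists B : C, forall s, s != e -> `|s - e| < r -> `|f s| <= B.

(* [cauchy_bound] for [f s ^+ N * ((s - e1) ^+ 2 * (s - e2) ^+ 2)]; the constants
   disappear as [N] grows. *)
Lemma max_modulus f a e1 e2 r (M : C) : 0 < r -> a != e1 -> a != e2 ->
  (forall s, `|s - a| <= 2 * r -> s != e1 -> s != e2 -> derivable f s 1) ->
  loc_bounded f e1 -> loc_bounded f e2 ->
  (forall s, r <= `|s - a| <= 2 * r -> `|f s| <= M) -> `|f a| <= M.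
Proof.
move=> r0 ae1 ae2 df b1 b2 fM.
have M0 : 0 <= M.
  apply: le_trans (fM (a + r) _) => //.
  by rewrite addrC addKr ger0_norm ?(ltW r0)// lexx ler_peMl ?(ltW r0)// ler1n.
pose D := (2 * r + `|a - e1|) ^+ 2 * (2 * r + `|a - e2|) ^+ 2.
have D0 : 0 <= D by rewrite mulr_ge0// exprn_ge0// addr_ge0// mulr_ge0// ltW.
apply: (@expr_bound_le _ _ (`|a - e1| ^+ 2 * `|a - e2| ^+ 2) (2 * D)) => // [|N].
  by rewrite mulr_gt0// exprn_gt0// normr_gt0 subr_eq0.
pose h s := f s ^+ N * ((s - e1) ^+ 2 * (s - e2) ^+ 2).
(* The points [e] and [e'] may coincide, as they do when [flat_eq0] passes 0 twice. *)
have sing e e' : loc_bounded f e -> derivable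
    (fun s => f s ^+ N * (s - e') ^+ 2 * (s - e) ^+ 2) e 1.
  move=> [r1 r10 [B hB]].
  apply: (@removable_sqr _ _ r1 (B ^+ N * (r1 + `|e - e'|) ^+ 2)) => // s se sr.
  rewrite normrM !normrX; apply: ler_pM; rewrite ?exprn_ge0//.
    by apply: lerXn2r; rewrite ?nnegrE ?(le_trans _ (hB s se sr))// hB.
  apply: lerXn2r; rewrite ?nnegrE ?addr_ge0 ?(ltW r10)//.
  rewrite -[s](subrK e) -addrA (le_trans (ler_normD _ _))// lerD2r; exact: ltW.
have dh s : `|s - a| <= 2 * r -> derivable h s 1.
  move=> sr; have [->|se1] := eqVneq s e1.
    rewrite (_ : h = fun s => f s ^+ N * (s - e2) ^+ 2 * (s - e1) ^+ 2); first exact: sing.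
    by apply/funext => x; rewrite /h -mulrA [X in _ * X]mulrC.
  have [->|se2] := eqVneq s e2.
    rewrite (_ : h = fun s => f s ^+ N * (s - e1) ^+ 2 * (s - e2) ^+ 2); first exact: sing.
    by apply/funext => x; rewrite /h mulrA.
  apply: derivable_exprM; first exact: df.
  rewrite (_ : (fun s => _) = (fun s => (s - e1) ^+ 2) * (fun s => (s - e2) ^+ 2)).
    by apply: derivableM; apply: derivable_sqr_subr.
  by apply/funext.
rewrite -!normrX -!normrM -(mulrA 2) (mulrC D).
apply: (cauchy_bound CG r0 dh) => s /andP[rs sr].
have bnd e : `|s - e| ^+ 2 <= (2 * r + `|a - e|) ^+ 2.
  apply: lerXn2r; rewrite ?nnegrE ?addr_ge0 ?mulr_ge0 ?(ltW r0)//.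
  by rewrite -[s](subrK a) -addrA (le_trans (ler_normD _ _))// lerD2r.
rewrite /h normrM !normrM !normrX; apply: ler_pM.
- by rewrite exprn_ge0.
- by rewrite mulr_ge0 ?exprn_ge0.
- by apply: lerXn2r; rewrite ?nnegrE// fM// rs.
- by apply: ler_pM; rewrite ?exprn_ge0// bnd.
Qed.

End RemovableSingularities.

(** * Orders of vanishing *)

Section Vanishing.
Variable C : numClosedFieldType.
Hypothesis CG : goursat_field C.
Implicit Types (f g u : C -> C) (s t p a b e r : C) (m : nat).

(** Apply [max_modulus] at [a] to [s |-> (g s - g b) / (s - b)], with exceptional points [b] and 0.
    On [4 d <= |s - a| <= 8 d] the numerator is at most [2 M] and the denominator at least [2 d]. *)
Lemma lipschitz_punctured g d (M : C) : 0 < d ->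
  (forall s, s != 0 -> `|s| < 16 * d -> derivable g s 1) ->
  (forall s, s != 0 -> `|s| < 16 * d -> `|g s| <= M) ->
  forall a b, a != 0 -> `|a| < d -> b != 0 -> `|b| < d ->
    `|g a - g b| <= M / d * `|a - b|.
Proof.
move=> d0 dg gM a b a0 ad b0 bd.
have [->|ab] := eqVneq a b; first by rewrite !subrr normr0 mulr0.
have ab0 : 0 < `|a - b| by rewrite normr_gt0 subr_eq0.
have d16 c : 0 < c -> c <= 16 -> c * d <= 16 * d.
  by move=> c0 c16; rewrite ler_pM2r.
have lt16 s : `|s| < d -> `|s| < 16 * d.
  by move=> sd; apply: lt_le_trans sd _; rewrite -[leLHS]mul1r d16// ler1n.
have M0 : 0 <= M by apply: le_trans (gM a a0 (lt16 _ ad)).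
suff: `|(g a - g b) / (a - b)| <= M / d by rewrite normrM normfV ler_pdivrMr.
apply: (@max_modulus C CG (fun s => (g s - g b) / (s - b)) a b 0 (4 * d)) => //.
- by rewrite mulr_gt0.
- move=> s; rewrite mulrA -natrM => sa sb s0; apply: derivable_diff_quotient => //.
  apply: dg => //; rewrite -[s](subrK a) (le_lt_trans (ler_normD _ _))//.
  rewrite (lt_le_trans (ler_ltD sa ad))// -[X in _ + X]mul1r -mulrDl.
  by rewrite d16 ?addr_gt0// natr1 ler_nat.
- have [r r0 [B hB]] := diff_quotient_bounded (dg b b0 (lt16 _ bd)).
  by exists r => //; exists B => s _; apply: hB.
- have b2 : 0 < `|b| / 2 by rewrite divr_gt0// normr_gt0.
  exists (`|b| / 2) => //; exists ((M + M) / (`|b| / 2)) => s s0; rewrite subr0 => sb.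
  have bs : `|b| / 2 <= `|s - b|.
    rewrite distrC (le_trans _ (lerB_normD _ _))// normrN lerBrDr.
    by rewrite [leRHS]splitr lerD2l ltW.
  rewrite normrM normfV ler_pM ?invr_ge0//.
    rewrite (le_trans (ler_normB _ _))// lerD//; last by apply: gM => //; apply: lt16.
    apply: gM => //; apply: lt16; apply: lt_trans sb _; apply: le_lt_trans bd.
    by rewrite ler_pdivrMr// ler_peMr// ler1n.
  by rewrite lef_pV2// posrE// (lt_le_trans b2).
move=> s /andP[rs]; rewrite mulrA -natrM => sr.
have sb : 2 * d <= `|s - b|.
  have : `|s - a| <= `|s - b| + `|b - a| by rewrite -{1}(subrK b s) -addrA ler_normD.
  move=> /(le_trans rs) h.
  have ba : `|b - a| <= 2 * d.
    by rewrite (le_trans (ler_normB _ _))// mulr2n mulrDl mul1r lerD// ltW.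
  have := le_trans h (lerD (lexx _) ba); rewrite -lerBlDr -mulrBl.
  by rewrite -natrB.
have s3 : 3 * d <= `|s|.
  have : `|s - a| <= `|s| + `|a| by rewrite ler_normB.
  move=> /(le_trans rs) h; have := le_trans h (lerD (lexx _) (ltW ad)).
  by rewrite -lerBlDr (_ : 4 * d - d = 3 * d)//; ring.
have s0 : s != 0 by rewrite -normr_gt0 (lt_le_trans _ s3)// mulr_gt0.
have s16 : `|s| < 16 * d.
  rewrite -[s](subrK a) (le_lt_trans (ler_normD _ _))//.
  rewrite (lt_le_trans (ler_ltD sr ad))// -[X in _ + X]mul1r -mulrDl.
  by rewrite d16 ?addr_gt0// natr1 ler_nat.
have d2 : 0 < 2 * d by rewrite mulr_gt0.
have -> : M / d = (M + M) / (2 * d) by field; rewrite gt_eqF.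
rewrite normrM normfV ler_pM ?invr_ge0//.
  by rewrite (le_trans (ler_normB _ _))// lerD// gM// lt16.
by rewrite lef_pV2// posrE// (lt_le_trans d2).
Qed.

Lemma derive_le_lipschitz f p r (K : C) : derivable f p 1 -> 0 < r ->
  (forall s, `|s - p| < r -> `|f s - f p| <= K * `|s - p|) -> `|'D_1 f p| <= K.
Proof.
move=> df r0 fK; apply/ler_addgt0Pr => e e0.
have [q q0 hq] := derivable_approx df e0.
have [r1 r10 [r1r r1q]] := common_radius r0 q0.
pose h := r1 / 2; have h0 : 0 < h by rewrite divr_gt0.
have hr1 : h < r1 by rewrite /h ltr_pdivrMr// ltr_pMr// ltr1n.
have nh : `|h| = h by rewrite ger0_norm// ltW.
have := fK (p + h); have := hq (p + h); rewrite addrAC subrr add0r nh.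
move=> /(_ (lt_le_trans hr1 r1q)) h1 /(_ (lt_le_trans hr1 r1r)) h2.
rewrite -(@ler_pM2r _ h)// -{1}nh -normrM mulrDl.
rewrite -[X in `|X|](subKr (f (p + h) - f p)).
by rewrite (le_trans (ler_normB _ _))// lerD.
Qed.

(* [u t = O(t ^+ m)] as [t] tends to 0, whatever the value of [u] at 0. *)
Definition bigOX m u : Prop := exists2 r, 0 < r &
  exists B : C, forall t, t != 0 -> `|t| < r -> `|u t| <= B * `|t| ^+ m.

Lemma bigOX_ext m f g r : 0 < r -> (forall t, t != 0 -> `|t| < r -> f t = g t) ->
  bigOX m f -> bigOX m g.
Proof.
move=> r0 fg [r1 r10 [B hB]]; have [q q0 [qr qr1]] := common_radius r0 r10.
exists q => //; exists B => t t0 tq; rewrite -fg ?(lt_le_trans tq)//.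
by apply: hB; rewrite ?(lt_le_trans tq).
Qed.

Lemma bigOXD m f g : bigOX m f -> bigOX m g -> bigOX m (fun t => f t + g t).
Proof.
move=> [r r0 [B hB]] [r1 r10 [B1 hB1]]; have [q q0 [qr qr1]] := common_radius r0 r10.
exists q => //; exists (B + B1) => t t0 tq; rewrite mulrDl.
by rewrite (le_trans (ler_normD _ _))// lerD ?hB ?hB1// (lt_le_trans tq).
Qed.

Lemma bigOXM m m' f g : bigOX m f -> bigOX m' g -> bigOX (m + m') (fun t => f t * g t).
Proof.
move=> [r r0 [B hB]] [r1 r10 [B1 hB1]]; have [q q0 [qr qr1]] := common_radius r0 r10.
exists q => //; exists (B * B1) => t t0 tq; rewrite normrM exprD mulrACA.
by rewrite ler_pM ?hB ?hB1// (lt_le_trans tq).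
Qed.

Lemma bigOX_cst (c : C) : bigOX 0 (fun=> c).
Proof. by exists 1 => //; exists `|c| => t _ _; rewrite expr0 mulr1. Qed.

Lemma bigOX_id : bigOX 1 id.
Proof. by exists 1 => //; exists 1 => t _ _; rewrite expr1 mul1r. Qed.

Lemma bigOXZ m (c : C) f : bigOX m f -> bigOX m (fun t => c * f t).
Proof. by move=> hf; have := bigOXM (bigOX_cst c) hf. Qed.

Lemma bigOXB m f g : bigOX m f -> bigOX m g -> bigOX m (fun t => f t - g t).
Proof.
move=> hf /(bigOXZ (-1)) hg; apply: bigOX_ext (@ltr01 C) _ (bigOXD hf hg) => t _ _ /=.
by rewrite mulN1r.
Qed.

Lemma bigOX_sum m (I : Type) (l : seq I) (F : I -> C -> C) :
  (forall i, bigOX m (F i)) -> bigOX m (fun t => \sum_(i <- l) F i t).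
Proof.
move=> hF; elim: l => [|i l IHl].
  by exists 1 => //; exists 0 => t _ _; rewrite big_nil normr0 mul0r.
by apply: bigOX_ext (@ltr01 C) _ (bigOXD (hF i) IHl) => t _ _; rewrite big_cons.
Qed.

Lemma bigOX_weaken m m' f : (m' <= m)%N -> bigOX m f -> bigOX m' f.
Proof.
move=> mm [r r0 [B hB]]; have [q q0 [qr q1]] := common_radius r0 (@ltr01 C).
exists q => //; exists B => t t0 tq; have := hB t t0 (lt_le_trans tq qr).
have tp : 0 < `|t| ^+ m by rewrite exprn_gt0// normr_gt0.
move=> h; have B0 : 0 <= B by rewrite -(pmulr_lge0 _ tp) (le_trans _ h).
apply: le_trans h _; rewrite ler_wpM2l// ler_wiXn2l//.
by rewrite ltW// (lt_le_trans tq).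
Qed.

Lemma bigOX_cancel_id m f : bigOX m.+1 (fun t => t * f t) -> bigOX m f.
Proof.
move=> [r r0 [B hB]]; exists r => //; exists B => t t0 tr.
have tp : 0 < `|t| by rewrite normr_gt0.
by rewrite -(ler_pM2l tp) -normrM mulrCA -exprS hB.
Qed.

Lemma bigOX_cancel_cst m (c : C) f : c != 0 -> bigOX m (fun t => c * f t) -> bigOX m f.
Proof.
move=> c0 /(bigOXZ c^-1); apply: bigOX_ext (@ltr01 C) _ => t _ _.
by rewrite mulKf.
Qed.

End Vanishing.

(** * Taylor estimates and flat functions *)

Section PuncturedDisc.
Variable C : numClosedFieldType.
Hypothesis CG : goursat_field C.
Implicit Types (f g u : C -> C) (s t p a b e r d : C) (m : nat).

Lemma derive_subr_cst f (c : C) p : derivable f p 1 -> 'D_1 (fun t => f t - c) p = 'D_1 f p.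
Proof.
move=> df; rewrite (_ : (fun t => f t - c) = f - cst c); last by apply/funext.
rewrite deriveB; [|exact: df|exact: derivable_cst].
by rewrite derive_cst subr0.
Qed.

(** The form of the derivative is chosen so that its product with [p ^+ m.+2] is the expression of
    [bigOX_euler]. *)
Lemma is_derive_divX g m p : p != 0 -> derivable g p 1 ->
  is_derive p 1 (fun t => g t / t ^+ m.+1)
    (('D_1 g p - m.+1%:R * (g p / p)) / p ^+ m.+1).
Proof.
move=> p0 dg; have pm0 : p ^+ m.+1 != 0 by rewrite expf_neq0.
have dX : derivable (id ^+ m.+1 : C -> C) p 1 by apply: derivableX; exact: derivable_id.
have E : (fun t : C => g t / t ^+ m.+1) = g * (fun t => ((id ^+ m.+1 : C -> C) t)^-1).
  by apply/funext => t; rewrite -[RHS]/(g t / _) exprfctE.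
have nz : (id ^+ m.+1 : C -> C) p != 0 by rewrite exprfctE.
have dV := derivableV nz dX.
rewrite E; apply: DeriveDef; first by apply: derivableM; [exact: dg|exact: dV].
rewrite deriveM; [|exact: dg|exact: dV].
rewrite deriveV; [|exact: nz|exact: dX].
rewrite deriveX; last exact: derivable_id.
rewrite derive_id !exprfctE -[_ *: 1]/(_ * 1).
rewrite -![_ *: _]/(_ * _).
rewrite -[m.+1.-1]/m (exprS p m); have q0 : p ^+ m != 0 by rewrite expf_neq0.
by move: (p ^+ m) q0 ('D_1 g p) (g p) (m.+1%:R : C) => q q0 D G M; field; apply/andP.
Qed.

(* [g t = t ^+ m.+1 * u t] with [u] bounded, hence Lipschitz, near 0; the function
   in the conclusion is [t ^+ m.+2 * u' t]. *)
Lemma bigOX_euler g m d : 0 < d ->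
  (forall t, t != 0 -> `|t| < d -> derivable g t 1) -> bigOX m.+1 g ->
  bigOX m.+2 (fun t => t * 'D_1 g t - m.+1%:R * g t).
Proof.
move=> d0 dg [r r0 [B hB]]; have [q q0 [qd qr]] := common_radius d0 r0.
(* [lipschitz_punctured] needs its bound on a disc 16 times larger. *)
pose e := q / 16; have e0 : 0 < e by rewrite divr_gt0.
have e16 : 16 * e = q by rewrite /e mulrCA mulfV ?mulr1.
have dgam t : t != 0 -> `|t| < 16 * e -> is_derive t 1 (fun t => g t / t ^+ m.+1)
    (('D_1 g t - m.+1%:R * (g t / t)) / t ^+ m.+1).
  by rewrite e16 => t0 tq; apply: is_derive_divX => //; apply: dg => //; apply: lt_le_trans qd.
have lip : forall a b, a != 0 -> `|a| < e -> b != 0 -> `|b| < e ->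
    `|g a / a ^+ m.+1 - g b / b ^+ m.+1| <= B / e * `|a - b|.
  apply: (@lipschitz_punctured C CG (fun t => g t / t ^+ m.+1)) => // u u0 ue.
    by have [] := dgam u u0 ue.
  move: ue; rewrite e16 => uq.
  rewrite normrM normfV normrX ler_pdivrMr ?exprn_gt0 ?normr_gt0// hB//.
  exact: lt_le_trans qr.
exists e => //; exists (B / e) => t t0 te.
have tp : 0 < `|t| by rewrite normr_gt0.
have te16 : `|t| < 16 * e.
  by apply: lt_trans te _; rewrite -[ltLHS]mul1r ltr_pM2r// ltr1n.
have [dgt Dgt] := dgam t t0 te16.
have et0 : 0 < e - `|t| by rewrite subr_gt0.
(* The disc of radius [r1] around [t] avoids 0 and stays inside [|s| < e]. *)
have [r1 r10 [r1t r1e]] := common_radius tp et0.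
have : `|'D_1 (fun t => g t / t ^+ m.+1) t| <= B / e.
  apply: (derive_le_lipschitz dgt r10) => s str; apply: lip => //.
  - apply/eqP => s0; move: (lt_le_trans str r1t).
    by rewrite s0 sub0r normrN ltxx.
  - rewrite -[s](subrK t) (le_lt_trans (ler_normD _ _))//.
    by rewrite -ltrBrDr (lt_le_trans str).
rewrite Dgt => h.
have -> : t * 'D_1 g t - m.+1%:R * g t =
    ('D_1 g t - m.+1%:R * (g t / t)) / t ^+ m.+1 * t ^+ m.+2.
  rewrite (exprS t m.+1); have P0 : t ^+ m.+1 != 0 by rewrite expf_neq0.
  by move: (t ^+ m.+1) P0 ('D_1 g t) (g t) (m.+1%:R : C) => P P0 D G M; field; apply/andP.
by rewrite normrM normrX ler_wpM2r ?exprn_ge0.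
Qed.

Lemma bigOX_derivable1 f : derivable f 0 1 -> bigOX 1 (fun t => f t - f 0).
Proof.
move=> df; have [r r0 [B hB]] := diff_quotient_bounded df.
exists r => //; exists B => t t0 tr; rewrite expr1.
have := hB t; rewrite subr0 normrM normfV ler_pdivrMr ?normr_gt0//; exact.
Qed.

Lemma bigOX_derivable0 f : derivable f 0 1 -> bigOX 0 f.
Proof.
move=> /bigOX_derivable1/(@bigOX_weaken _ 1 0 _ isT) h.
apply: bigOX_ext (@ltr01 C) _ (bigOXD h (bigOX_cst (f 0))) => t _ _.
by rewrite subrK.
Qed.

(** The quotient [(f t - f 0) / t] is bounded, hence Lipschitz, off 0; comparing it at [t] with its
    values at points [b] close to 0 gives its distance to the derivative at 0. *)
Lemma bigOX_taylor2 f d : 0 < d -> (forall t, `|t| < d -> derivable f t 1) ->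
  bigOX 2 (fun t => f t - f 0 - t * 'D_1 f 0).
Proof.
move=> d0 df; have df0 : derivable f 0 1 by apply: df; rewrite normr0.
have [r r0 [B hB]] := diff_quotient_bounded df0.
have [q q0 [qd qr]] := common_radius d0 r0.
pose e := q / 16; have e0 : 0 < e by rewrite divr_gt0.
have e16 : 16 * e = q by rewrite /e mulrCA mulfV ?mulr1.
have lip : forall a b, a != 0 -> `|a| < e -> b != 0 -> `|b| < e ->
    `|(f a - f 0) / (a - 0) - (f b - f 0) / (b - 0)| <= B / e * `|a - b|.
  apply: (@lipschitz_punctured C CG (fun t => (f t - f 0) / (t - 0))).
  - exact: e0.
  - move=> t t0; rewrite e16 => tq; apply: derivable_diff_quotient; last exact: t0.
    by apply: df; apply: lt_le_trans qd.
  - by move=> t t0; rewrite e16 => tq; apply: hB; rewrite subr0; apply: lt_le_trans qr.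
have Be : 0 <= B / e.
  rewrite divr_ge0 ?(ltW e0)//; apply: le_trans (hB 0 _) => //.
  by rewrite subrr normr0.
exists e => //; exists (B / e) => t t0 te.
have tp : 0 < `|t| by rewrite normr_gt0.
have -> : f t - f 0 - t * 'D_1 f 0 = ((f t - f 0) / (t - 0) - 'D_1 f 0) * t.
  by rewrite subr0; field.
rewrite normrM expr2 mulrA ler_pM2r//; apply/ler_addgt0Pr => x x0.
(* With [y] this quotient, the errors add up to [(B / e) * y + y = x]. *)
have y0 : 0 < x / (B / e + 1) by rewrite divr_gt0// ltr_wpDl.
have [z z0 hz] := derivable_approx df0 y0.
have [w w0 [we]] : exists2 w, 0 < w & w <= e /\ w <= z /\ w <= x / (B / e + 1).
  have [w1 w10 [w1e w1z]] := common_radius e0 z0.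
  have [w w0 [ww wy]] := common_radius w10 y0.
  by exists w => //; split; [|split=> //]; apply: le_trans ww _.
move=> [wz wx].
pose b := w / 2; have b0 : 0 < b by rewrite divr_gt0.
have bn0 : b != 0 by rewrite gt_eqF.
have nb : `|b| = b by rewrite ger0_norm// ltW.
have bw : b < w by rewrite /b ltr_pdivrMr// ltr_pMr// ltr1n.
have h1 := lip t b t0 te bn0; rewrite nb in h1; have {h1} := h1 (lt_le_trans bw we).
have h2 : `|(f b - f 0) / (b - 0) - 'D_1 f 0| <= x / (B / e + 1).
  have := hz b; rewrite !subr0 nb => /(_ (lt_le_trans bw wz)) h2.
  rewrite -(@ler_pM2r _ b)// -[X in _ * X <= _]nb -normrM.
  by rewrite mulrBl divfK.
move=> h1; have tb : `|t - b| <= `|t| + x / (B / e + 1).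
  by rewrite (le_trans (ler_normB _ _))// lerD2l nb (le_trans (ltW bw)).
have -> : (f t - f 0) / (t - 0) - 'D_1 f 0 =
  (f t - f 0) / (t - 0) - (f b - f 0) / (b - 0) + ((f b - f 0) / (b - 0) - 'D_1 f 0).
  by rewrite addrA subrK.
rewrite (le_trans (ler_normD _ _))//.
apply: (le_trans (lerD (le_trans h1 (ler_wpM2l Be tb)) h2)).
have K1 : B / e + 1 != 0 by rewrite gt_eqF// ltr_wpDl.
move: (B / e) K1 => K K1; rewrite [leLHS](_ : _ = K * `|t| + x)//.
by field.
Qed.

(** Add [bigOX_euler] for [f - f 0] with [m = 0] to [bigOX_taylor2]: the terms [f t - f 0] cancel,
    and a factor [t] can be divided out. *)
Lemma bigOX_derive f d : 0 < d -> (forall t, `|t| < d -> derivable f t 1) ->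
  bigOX 1 (fun t => 'D_1 f t - 'D_1 f 0).
Proof.
move=> d0 df; have df0 : derivable f 0 1 by apply: df; rewrite normr0.
have dg t : t != 0 -> `|t| < d -> derivable (fun t => f t - f 0) t 1.
  move=> _ td; have dft := df _ td.
  rewrite (_ : (fun t => f t - f 0) = f - cst (f 0)); last by apply/funext.
  by apply: derivableB; [exact: dft|exact: derivable_cst].
have := bigOXD (bigOX_euler d0 dg (bigOX_derivable1 df0)) (bigOX_taylor2 d0 df).
move=> h; apply: bigOX_cancel_id; apply: bigOX_ext d0 _ h => t _ td.
by rewrite (derive_subr_cst _ (df _ td)); ring.
Qed.

(** Apply [max_modulus] at [t] to [g s / s ^+ m.+1]. On [3 d <= |s - t| <= 6 d] one has
    [|s| >= 2 d], so [|g t| <= M * (|t| / (2 d)) ^+ m.+1] for every [m]. The radii on which flatness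
    holds do not enter. *)
Lemma flat_eq0 g d (M : C) : 0 < d ->
  (forall t, `|t| < 12 * d -> derivable g t 1) ->
  (forall t, `|t| < 12 * d -> `|g t| <= M) -> (forall m, bigOX m g) ->
  forall t, t != 0 -> `|t| < d -> g t = 0.
Proof.
move=> d0 dg gM flat t t0 td; have tp : 0 < `|t| by rewrite normr_gt0.
have M0 : 0 <= M by apply: le_trans (gM 0 _) => //; rewrite normr0 mulr_gt0.
suff H m : `|g t| <= M * 2^-1 ^+ m.+1.
  apply/eqP; rewrite -normr_le0; apply/ler_addgt0Pr => e e0; rewrite add0r.
  have [J HJ] := CG.1 _ _ M0 e0.
  by apply: le_trans (H J) _; apply: ltW; apply: HJ.
have d2 : 0 < 2 * d by rewrite mulr_gt0.
have lt12 s : `|s - t| <= 6 * d -> `|s| < 12 * d.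
  move=> st; rewrite -[s](subrK t) (le_lt_trans (ler_normD _ _))//.
  rewrite (lt_le_trans (ler_ltD st td))// -[X in _ + X]mul1r -mulrDl.
  by rewrite ler_pM2r// natr1 ler_nat.
have loc : loc_bounded (fun s => g s / s ^+ m.+1) 0.
  have [r r0 [B hB]] := flat m.+1.
  exists r => //; exists B => s s0; rewrite subr0 => sr.
  by rewrite normrM normfV normrX ler_pdivrMr ?exprn_gt0 ?normr_gt0// hB.
have : `|g t / t ^+ m.+1| <= M / (2 * d) ^+ m.+1.
  apply: (@max_modulus C CG (fun s => g s / s ^+ m.+1) t 0 0 (3 * d)).
  - by rewrite mulr_gt0.
  - exact: t0.
  - exact: t0.
  - move=> s; rewrite mulrA -natrM => st s0 _.
    by have [] := @is_derive_divX g m s s0 (dg s (lt12 s st)).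
  - exact: loc.
  - exact: loc.
  move=> s /andP[rs]; rewrite mulrA -natrM => sr.
  have s2 : 2 * d <= `|s|.
    have : `|s - t| <= `|s| + `|t| by rewrite ler_normB.
    move=> /(le_trans rs) h; have := le_trans h (lerD (lexx _) (ltW td)).
    by rewrite -lerBlDr (_ : 3 * d - d = 2 * d)//; ring.
  rewrite normrM normfV normrX ler_pM ?invr_ge0 ?exprn_ge0//; first exact: gM (lt12 s sr).
  rewrite lef_pV2 ?posrE ?exprn_gt0//; last exact: lt_le_trans s2.
  by apply: lerXn2r; rewrite ?nnegrE// ltW.
rewrite normrM normfV normrX ler_pdivrMr ?exprn_gt0// => h; apply: le_trans h _.
rewrite -mulrA; apply: ler_wpM2l => //.
have tle : `|t| / (2 * d) <= 2^-1.
  by rewrite ler_pdivrMr// mulrA mulVf// mul1r ltW.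
by rewrite mulrC -expr_div_n; apply: lerXn2r tle; rewrite nnegrE ?divr_ge0// ltW.
Qed.

End PuncturedDisc.

(** * Holomorphic solutions *)

Section LineUniqueness.
Variable C : numClosedFieldType.
Hypothesis CG : goursat_field C.
Variables (n : nat) (phi : 'I_n -> C -> C) (b : 'I_n -> C) (d : C).
Variables F1 F2 : 'I_n -> 'I_n -> C -> C.
Let dphi k := 'D_1 (phi k).
Hypothesis d_gt0 : 0 < d.
Hypothesis phi_derivable : forall k t, `|t| < d -> derivable (phi k) t 1.
Hypothesis F1_derivable : forall k h t, `|t| < d -> derivable (F1 k h) t 1.
Hypothesis F2_derivable : forall k h t, `|t| < d -> derivable (F2 k h) t 1.
Hypothesis F1_diag : forall k t, `|t| < d -> F1 k k t = 0.
Hypothesis F2_diag : forall k t, `|t| < d -> F2 k k t = 0.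
Hypothesis dphi_neq : forall k h, k != h -> dphi h 0 != dphi k 0.
Hypothesis b_nonres : forall k h, phi h 0 = phi k 0 ->
  forall m : int, m != 0 -> b h - b k <> m%:~R.
Hypothesis F12_init : forall k h, F1 k h 0 = F2 k h 0.

Definition line_equation (F : 'I_n -> 'I_n -> C -> C) t : Prop :=
  forall k h, k != h ->
  (phi h t - phi k t) * 'D_1 (F k h) t =
  (b h - b k - 1) * ((dphi h t - dphi k t) * F k h t)
  + \sum_(l < n) (dphi l t - dphi k t) * (phi h t - phi l t) * (F k l t * F l h t)
  - \sum_(l < n) (phi l t - phi k t) * (dphi h t - dphi l t) * (F k l t * F l h t).

Hypothesis F1_eq : forall t, `|t| < d -> line_equation F1 t.
Hypothesis F2_eq : forall t, `|t| < d -> line_equation F2 t.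

Let G k h t := F1 k h t - F2 k h t.
Let D k h l t := F1 k l t * F1 l h t - F2 k l t * F2 l h t.
Let W k h l t := (dphi l t - dphi k t) * (phi h t - phi l t) -
                 (phi l t - phi k t) * (dphi h t - dphi l t).

Let n0 : `|0 : C| < d. Proof. by rewrite normr0. Qed.

Let G_derivable k h t : `|t| < d -> derivable (G k h) t 1.
Proof.
move=> td; have -> : G k h = F1 k h - F2 k h by apply/funext.
by apply: derivableB; [exact: F1_derivable|exact: F2_derivable].
Qed.

Let G_eq k h t : k != h -> `|t| < d ->
  (phi h t - phi k t) * 'D_1 (G k h) t =
  (b h - b k - 1) * ((dphi h t - dphi k t) * G k h t) +
  \sum_(l < n) W k h l t * D k h l t.
Proof.
move=> kh td; have -> : G k h = F1 k h - F2 k h by apply/funext.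
rewrite deriveB; [|exact: F1_derivable|exact: F2_derivable].
rewrite mulrBr F1_eq// F2_eq//.
rewrite [X in _ = _ + X](_ : _ =
   \sum_(l < n) (dphi l t - dphi k t) * (phi h t - phi l t) * (F1 k l t * F1 l h t)
  - \sum_(l < n) (phi l t - phi k t) * (dphi h t - dphi l t) * (F1 k l t * F1 l h t)
  - (\sum_(l < n) (dphi l t - dphi k t) * (phi h t - phi l t) * (F2 k l t * F2 l h t)
  - \sum_(l < n) (phi l t - phi k t) * (dphi h t - dphi l t) * (F2 k l t * F2 l h t))).
  by rewrite /G -[(F1 k h - F2 k h) t]/(_ - _); ring.
by rewrite -!sumrB; apply: eq_bigr => l _; rewrite /W /D; ring.
Qed.

Let phi_O0 k : bigOX 0 (phi k).
Proof. by apply: bigOX_derivable0; exact: phi_derivable. Qed.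

Let dphi_O0 k : bigOX 0 (dphi k).
Proof.
have := bigOX_derive CG d_gt0 (@phi_derivable k) => /(@bigOX_weaken _ 1 0 _ isT) h.
apply: bigOX_ext d_gt0 _ (bigOXD h (bigOX_cst (dphi k 0))) => t _ _.
by rewrite subrK.
Qed.

Let phi_O1 k h : phi h 0 = phi k 0 -> bigOX 1 (fun t => phi h t - phi k t).
Proof.
move=> e; have := bigOXB (bigOX_derivable1 (@phi_derivable h 0 n0))
  (bigOX_derivable1 (@phi_derivable k 0 n0)).
by apply: bigOX_ext d_gt0 _ => t _ _; rewrite e; ring.
Qed.

Let W_O0 k h l : bigOX 0 (W k h l).
Proof.
have := bigOXB (bigOXM (bigOXB (dphi_O0 l) (dphi_O0 k)) (bigOXB (phi_O0 h) (phi_O0 l)))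
  (bigOXM (bigOXB (phi_O0 l) (phi_O0 k)) (bigOXB (dphi_O0 h) (dphi_O0 l))).
exact.
Qed.

(** Each of the two products in [W] has a factor [phi - phi] that vanishes at 0. *)
Let W_O1 k h l : phi h 0 = phi k 0 -> phi l 0 = phi h 0 -> bigOX 1 (W k h l).
Proof.
move=> e1 e2; have := bigOXB
  (bigOXM (bigOXB (dphi_O0 l) (dphi_O0 k)) (phi_O1 (esym e2)))
  (bigOXM (phi_O1 (etrans e2 e1)) (bigOXB (dphi_O0 h) (dphi_O0 l))).
exact.
Qed.

Let D_O m k h l : bigOX m (G k l) -> bigOX m (G l h) -> bigOX m (D k h l).
Proof.
move=> h1 h2; have f1 := bigOX_derivable0 (@F1_derivable l h 0 n0).
have f2 := bigOX_derivable0 (@F2_derivable k l 0 n0).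
have := bigOXM f1 h1; have := bigOXM f2 h2; rewrite add0n => o2 o1.
apply: bigOX_ext d_gt0 _ (bigOXD o1 o2) => t _ _; rewrite /D /G; ring.
Qed.

Let G_euler m k h : bigOX m.+1 (G k h) ->
  bigOX m.+2 (fun t => t * 'D_1 (G k h) t - m.+1%:R * G k h t).
Proof.
apply: (bigOX_euler CG d_gt0) => t _; exact: G_derivable.
Qed.

(** With [w = phi h - phi k], multiply [G_eq] by [t], replace [t * G'] by [m.+1 * G] using
    [G_euler], and [w] by [w 0]: all errors are [O(t ^+ m.+2)], and [w 0 * m.+1 * G] remains. *)
Let regular_order m k h : (forall k h, bigOX m.+1 (G k h)) -> phi h 0 <> phi k 0 ->
  bigOX m.+2 (G k h).
Proof.
move=> hG phk; have kh : k != h by apply/eqP => e; apply: phk; rewrite e.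
pose w0 := phi h 0 - phi k 0; have w00 : w0 != 0 by rewrite subr_eq0; apply/eqP.
have S : bigOX m.+1 (fun t => \sum_(l < n) W k h l t * D k h l t).
  by apply: bigOX_sum => l; apply: (bigOXM (W_O0 k h l)); apply: D_O.
have w'G := bigOXM (bigOXB (dphi_O0 h) (dphi_O0 k)) (hG k h).
have rhs := bigOXM (bigOX_id C) (bigOXD (bigOXZ (b h - b k - 1) w'G) S).
have we := bigOXM (bigOXB (phi_O0 h) (phi_O0 k)) (G_euler (hG k h)).
have ww0 := bigOXM (bigOXB (bigOX_derivable1 (@phi_derivable h 0 n0))
  (bigOX_derivable1 (@phi_derivable k 0 n0))) (bigOXZ m.+1%:R (hG k h)).
have := bigOXB (bigOXB rhs we) ww0.
move=> o; apply: (@bigOX_cancel_cst _ _ (w0 * m.+1%:R)).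
  by rewrite mulf_neq0// pnatr_eq0.
apply: bigOX_ext d_gt0 _ o => t _ td /=.
rewrite -(G_eq kh td) /w0; ring.
Qed.

(** Now [w] is [t * L] up to [O(t ^+ 2)], and [w'] is [L] up to [O(t)]. Multiplied by [t], the
    equation leaves [t * (m.+1 - c) * L * G] up to [O(t ^+ m.+3)]; [m.+1 = c] would mean
    [b h - b k = m.+2]. *)
Let singular_order m k h : (forall k h, bigOX m.+1 (G k h)) -> k != h ->
  phi h 0 = phi k 0 -> bigOX m.+2 (G k h).
Proof.
move=> hG kh phk; pose L := dphi h 0 - dphi k 0.
have L0 : L != 0 by rewrite subr_eq0 dphi_neq.
pose c := b h - b k - 1.
have mc : m.+1%:R - c != 0.
  rewrite subr_eq0; apply/eqP => e; apply: (@b_nonres k h phk m.+2) => //.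
  by rewrite -[RHS]/(m.+2%:R) -natr1 e /c subrK.
(* The extra order comes from [W] if [phi l] takes the common value at 0, and from [regular_order]
   for both factors of [D] otherwise. *)
have S : bigOX m.+2 (fun t => \sum_(l < n) W k h l t * D k h l t).
  apply: bigOX_sum => l; have [e|/eqP e] := eqVneq (phi l 0) (phi h 0).
    exact: (bigOXM (W_O1 phk e) (D_O (hG k l) (hG l h))).
  apply: (bigOXM (W_O0 k h l) (D_O _ _)); apply: regular_order => //.
    by rewrite -phk.
  by move=> e'; apply: e.
have dw := bigOXB (bigOX_derive CG d_gt0 (@phi_derivable h))
  (bigOX_derive CG d_gt0 (@phi_derivable k)).
have w2 := bigOXB (bigOX_taylor2 CG d_gt0 (@phi_derivable h))
  (bigOX_taylor2 CG d_gt0 (@phi_derivable k)).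
have o1 := bigOXM (bigOX_id C) (bigOXM (bigOXZ c dw) (hG k h)).
have o2 := bigOXM (bigOX_id C) S.
have o3 := bigOXM (phi_O1 phk) (G_euler (hG k h)).
have o4 := bigOXM w2 (bigOXZ m.+1%:R (hG k h)).
have o := bigOXB (bigOXB (bigOXD o1 o2) o3) o4.
apply: bigOX_cancel_id; apply: (@bigOX_cancel_cst _ _ ((m.+1%:R - c) * L)).
  by rewrite mulf_neq0.
apply: bigOX_ext d_gt0 _ o => t _ td /=.
set S' := \sum_(l < n) _.
have -> : S' = (phi h t - phi k t) * 'D_1 (G k h) t - c * ((dphi h t - dphi k t) * G k h t).
  by rewrite (G_eq kh td) addrC addKr.
rewrite /L /dphi phk; ring.
Qed.

Lemma line_flat m k h : bigOX m (G k h).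
Proof.
elim: m k h => [|[|m] IHm] k h.
- by apply: bigOX_derivable0; exact: G_derivable.
- apply: bigOX_ext d_gt0 _ (bigOX_derivable1 (@G_derivable k h 0 n0)) => t _ _.
  by rewrite [G k h 0]/G F12_init subrr subr0.
have [<-|kh] := eqVneq k h.
  exists d => //; exists 0 => t _ td.
  by rewrite /G F1_diag// F2_diag// subrr normr0 mul0r.
have [e|/eqP e] := eqVneq (phi h 0) (phi k 0); first exact: singular_order.
exact: regular_order.
Qed.

Lemma line_uniqueness (e M : C) k h : d = 12 * e ->
  (forall t, `|t| < d -> `|F1 k h t - F2 k h t| <= M) ->
  forall t, t != 0 -> `|t| < e -> F1 k h t = F2 k h t.
Proof.
move=> de GM t t0 te; have e0 : 0 < e by move: d_gt0; rewrite de pmulr_rgt0.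
apply/eqP; rewrite -subr_eq0; apply/eqP; rewrite -[LHS]/(G k h t).
apply: (flat_eq0 CG e0 _ _ (fun m => line_flat m k h) t0 te) => s.
  by rewrite -de; apply: G_derivable.
by rewrite -de; apply: GM.
Qed.

End LineUniqueness.

(** * From lines to a neighborhood *)

Section HolomorphicUniqueness.
Variable C : numClosedFieldType.
Hypothesis CG : goursat_field C.
Variable d : nat.
Implicit Types (x v : 'rV[C]_d) (f : 'rV[C]_d -> C).

Lemma derive_sum_delta f x v : differentiable f x ->
  'D_v f x = \sum_i v 0 i * 'D_'e_i f x.
Proof.
move=> df; rewrite deriveE// [in LHS](row_sum_delta v) linear_sum.
by apply: eq_bigr => i _; rewrite linearZ deriveE.
Qed.

Lemma diff_neq_delta f g x : differentiable f x -> differentiable g x ->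
  'd f x <> 'd g x :> ('rV[C]_d -> C) -> exists i, 'D_'e_i f x != 'D_'e_i g x.
Proof.
move=> df dg neq; apply: contrapT => /forallNP h; apply: neq.
apply/funext => v; rewrite -(deriveE v df) -(deriveE v dg) !derive_sum_delta//.
by apply: eq_bigr => i _; have /negP := h i; rewrite negbK => /eqP ->.
Qed.

(** One identity of difference quotients serves both [derive] and [derivable]. *)
Lemma growth_line f x v (t : C) :
  (fun h : C => h^-1 *: (((fun s : C => f (x + s *: v)) \o shift t) (h *: 1)
     - f (x + t *: v))) =
  (fun h : C => h^-1 *: ((f \o shift (x + t *: v)) (h *: v) - f (x + t *: v))).
Proof.
apply/funext => h /=; congr (_ *: (f _ - _)).
by rewrite -[h *: 1]/(h * 1) mulr1 scalerDl addrCA.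
Qed.

Lemma derive_line f x v (t : C) :
  'D_1 (fun s : C => f (x + s *: v)) t = 'D_v f (x + t *: v).
Proof. by rewrite /derive growth_line. Qed.

Lemma derivable_line f x v (t : C) : differentiable f (x + t *: v) ->
  derivable (fun s : C => f (x + s *: v)) t 1.
Proof. by move=> df; have := @diff_derivable _ _ _ f _ v df; rewrite /derivable growth_line. Qed.

Lemma near_affine_neq0 (al be : C) : (al != 0) || (be != 0) ->
  \forall s \near 0^', al + s * be != 0.
Proof.
move=> ab; rewrite near_withinE; apply/nbhs_normP.
have [a0|a0] := eqVneq al 0.
  by move: ab; rewrite a0 eqxx /= => b0; exists 1 => //= s _ s0; rewrite add0r mulf_neq0.
have r0 : 0 < `|al| / (`|be| + 1) by rewrite divr_gt0 ?normr_gt0// ltr_wpDl.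
exists (`|al| / (`|be| + 1)) => //= s.
rewrite /ball_ /= sub0r normrN ltr_pdivlMr ?ltr_wpDl// => sr _.
apply: contraTneq sr => e; have -> : al = - (s * be) by apply/eqP; rewrite -addr_eq0 e.
by rewrite normrN normrM mulrDr mulr1 le_gtF// lerDl.
Qed.

(** Finitely many hyperplanes do not cover the space: if [v] suits [l] and [w] suits [j], then
    [v + s *: w] suits both for small nonzero [s]. *)
Lemma common_nonzero (I : finType) (l : seq I) (L : I -> 'rV[C]_d -> C) :
  (forall i v w (c : C), L i (v + c *: w) = L i v + c * L i w) ->
  (forall i, i \in l -> exists v, L i v != 0) ->
  exists v, forall i, i \in l -> L i v != 0.
Proof.
move=> linL; elim: l => [|j l IHl] hL; first by exists 0.
have [v hv] := IHl (fun i il => hL i (mem_behead (s := j :: l) il)).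
have [w hw] := hL j (mem_head j l).
have : \forall s \near 0^', forall i, i \in j :: l -> L i v + s * L i w != 0.
  apply: filter_forall => i; have [il|_] := boolP (i \in j :: l); last exact: filterE.
  have nz : (L i v != 0) || (L i w != 0).
    by move: il; rewrite in_cons => /orP[/eqP ->|/hv ->//]; rewrite hw orbT.
  by apply: filterS (near_affine_neq0 nz) => s hs _.
by move=> /filter_ex[s hs]; exists (v + s *: w) => i il; rewrite linL hs.
Qed.

Lemma bigOX1_cst (c : C) : bigOX 1 (fun=> c) -> c = 0.
Proof.
move=> [r r0 [B hB]]; apply/eqP; apply: contraT => c0.
have q0 : 0 < `|c| / (`|B| + 1) by rewrite divr_gt0 ?normr_gt0// ltr_wpDl.
have [t' t'0 [tr tq]] := common_radius r0 q0.
pose t := t' / 2; have t0 : 0 < t by rewrite divr_gt0.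
have nt : `|t| = t by rewrite ger0_norm// ltW.
have tt : t < t' by rewrite /t ltr_pdivrMr// ltr_pMr// ltr1n.
have tn0 : t != 0 by rewrite gt_eqF.
have := hB t tn0; rewrite nt expr1 => /(_ (lt_le_trans tt tr)) h.
have B0 : 0 <= B by rewrite -(pmulr_lge0 _ t0) (le_trans _ h).
have := lt_le_trans tt tq; rewrite ltr_pdivlMr ?ltr_wpDl// ger0_norm// mulrDr mulr1.
move=> /lt_le_trans/(_ h); rewrite mulrC => h2.
by move: h2; rewrite gtrDl => /(lt_trans t0); rewrite ltxx.
Qed.

Section Uniqueness.
Variables (n : nat) (x0 : 'rV[C]_d) (f : 'I_n -> 'rV[C]_d -> C) (b : 'I_n -> C).
Hypothesis f_holo : forall k, \forall x \near x0, differentiable (f k) x.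
Hypothesis df_neq : forall k h, k != h -> 'd (f k) x0 <> 'd (f h) x0 :> ('rV[C]_d -> C).
Hypothesis b_nonres : forall k h, f h x0 = f k x0 ->
  forall m : int, m != 0 -> b h - b k <> m%:~R.

Definition gradient_equation (F : 'I_n -> 'I_n -> 'rV[C]_d -> C) x : Prop :=
  forall i k h, k != h ->
  (f h x - f k x) * 'D_'e_i (F k h) x =
  (b h - b k - 1) * (('D_'e_i (f h) x - 'D_'e_i (f k) x) * F k h x)
  + \sum_(l < n) ('D_'e_i (f l) x - 'D_'e_i (f k) x) * (f h x - f l x) * (F k l x * F l h x)
  - \sum_(l < n) (f l x - f k x) * ('D_'e_i (f h) x - 'D_'e_i (f l) x) * (F k l x * F l h x).

(** Both sides are linear in the index of differentiation: multiply the equation for [i] by [v 0 i]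
    and sum over [i]. *)
Lemma gradient_line_equation F v (t : C) :
  (forall k, differentiable (f k) (x0 + t *: v)) ->
  (forall k h, differentiable (F k h) (x0 + t *: v)) ->
  gradient_equation F (x0 + t *: v) ->
  line_equation (fun k s => f k (x0 + s *: v)) b (fun k h s => F k h (x0 + s *: v)) t.
Proof.
move=> dfx dFx FE k h kh /=; rewrite !derive_line; under eq_bigr do rewrite !derive_line.
under [in X in _ = _ - X]eq_bigr do rewrite !derive_line.
move: (x0 + t *: v) dfx dFx FE => x dfx dFx FE.
rewrite !derive_sum_delta//.
rewrite mulr_sumr; under [LHS]eq_bigr => i _ do rewrite mulrCA (FE i k h kh) mulrBr mulrDr.
rewrite sumrB big_split /=; congr (_ + _ - _).
- rewrite -sumrB mulr_suml mulr_sumr; apply: eq_bigr => i _; ring.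
- under [LHS]eq_bigr do rewrite mulr_sumr; rewrite exchange_big; apply: eq_bigr => l _ /=.
  rewrite !derive_sum_delta// -sumrB !mulr_suml; apply: eq_bigr => i _; ring.
- under [LHS]eq_bigr do rewrite mulr_sumr; rewrite exchange_big; apply: eq_bigr => l _ /=.
  rewrite !derive_sum_delta// -sumrB mulr_sumr mulr_suml; apply: eq_bigr => i _; ring.
Qed.

Variables F1 F2 : 'I_n -> 'I_n -> 'rV[C]_d -> C.
Hypothesis F1_holo : forall k h, \forall x \near x0, differentiable (F1 k h) x.
Hypothesis F2_holo : forall k h, \forall x \near x0, differentiable (F2 k h) x.
Hypothesis F1_diag : \forall x \near x0, forall k, F1 k k x = 0.
Hypothesis F2_diag : \forall x \near x0, forall k, F2 k k x = 0.
Hypothesis F1_eq : \forall x \near x0, gradient_equation F1 x.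
Hypothesis F2_eq : \forall x \near x0, gradient_equation F2 x.
Hypothesis F12_init : forall k h, F1 k h x0 = F2 k h x0.

(** The last clause, obtained from continuity and the common initial value, provides the bound [M]
    of [line_uniqueness]. *)
Let good x : Prop := [/\ forall k, differentiable (f k) x,
  (forall k h, differentiable (F1 k h) x) /\ (forall k h, differentiable (F2 k h) x),
  (forall k, F1 k k x = 0) /\ (forall k, F2 k k x = 0),
  gradient_equation F1 x /\ gradient_equation F2 x &
  forall k h, `|F1 k h x - F2 k h x| <= 1].

Let near_good : \forall x \near x0, good x.
Proof.
have hf : \forall x \near x0, forall k, differentiable (f k) x.
  exact: filter_forall _ f_holo.
have h1 : \forall x \near x0, forall k h, differentiable (F1 k h) x.
  exact: filter_forall _ (fun k => filter_forall _ (F1_holo k)).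
have h2 : \forall x \near x0, forall k h, differentiable (F2 k h) x.
  exact: filter_forall _ (fun k => filter_forall _ (F2_holo k)).
have hM' k h : \forall x \near x0, `|F1 k h x - F2 k h x| <= 1.
  have c1 := differentiable_continuous (nbhs_singleton (F1_holo k h)).
  have c2 := differentiable_continuous (nbhs_singleton (F2_holo k h)).
  have : (F1 k h x - F2 k h x) @[x --> x0] --> F1 k h x0 - F2 k h x0
    by apply: (cvgB c1 c2).
  move=> /cvgrPdist_le/(_ 1 (@ltr01 C)).
  by rewrite /= F12_init subrr; apply: filterS => x; rewrite /= sub0r normrN.
have hM : \forall x \near x0, forall k h, `|F1 k h x - F2 k h x| <= 1.
  exact: filter_forall _ (fun k => filter_forall _ (hM' k)).
near=> x; split; [|split|split|split|].
- near: x; exact: hf.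
- near: x; exact: h1.
- near: x; exact: h2.
- near: x; exact: F1_diag.
- near: x; exact: F2_diag.
- near: x; exact: F1_eq.
- near: x; exact: F2_eq.
- near: x; exact: hM.
Unshelve. all: by end_near. Qed.

Let L (p : 'I_n * 'I_n) (v : 'rV[C]_d) : C := 'D_v (f p.2) x0 - 'D_v (f p.1) x0.

Let L_lin p v w (c : C) : L p (v + c *: w) = L p v + c * L p w.
Proof.
have D_lin k : 'D_(v + c *: w) (f k) x0 = 'D_v (f k) x0 + c * 'D_w (f k) x0.
  rewrite !derive_sum_delta; try exact: nbhs_singleton (f_holo k).
  rewrite mulr_sumr -big_split; apply: eq_bigr => i _ /=; rewrite !mxE.
  by rewrite mulrDl mulrA.
by rewrite /L !D_lin mulrBr opprD addrACA.
Qed.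

(** For [|t| < 24] the point [x0 + t *: v] stays in the ball of radius [r]. Since [24 = 12 * 2],
    [line_uniqueness] covers [|t| < 2], in particular [t = 1]. *)
Let generic_eq r v k h : 0 < r -> (forall x, `|x0 - x| < r -> good x) ->
  (forall p, p.1 != p.2 -> L p v != 0) -> `|v| < r / 24 ->
  F1 k h (x0 + v) = F2 k h (x0 + v).
Proof.
move=> r0 hr Lv vr.
have gt t : `|t| < 24 -> good (x0 + t *: v).
  move=> t24; apply: hr; rewrite opprD addrA subrr sub0r normrN normrZ.
  apply: (@le_lt_trans _ _ (24 * `|v|)); first by rewrite ler_wpM2r// ltW.
  by rewrite mulrC -ltr_pdivlMr.
have x00 : x0 + (0 : C) *: v = x0 by rewrite scale0r addr0.
have n24 : (24 : C) = 12 * 2 by rewrite -natrM.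
have {1 2}-> : x0 + v = x0 + (1 : C) *: v by rewrite scale1r.
apply: (@line_uniqueness C CG n (fun k s => f k (x0 + s *: v)) b 24
  (fun k h s => F1 k h (x0 + s *: v)) (fun k h s => F2 k h (x0 + s *: v))
  _ _ _ _ _ _ _ _ _ _ _ 2 1 k h n24) => //.
- by move=> k' t /gt[hf _ _ _ _]; apply: derivable_line.
- by move=> k' h' t /gt[_ [h1 _] _ _ _]; apply: derivable_line.
- by move=> k' h' t /gt[_ [_ h2] _ _ _]; apply: derivable_line.
- by move=> k' t /gt[_ _ [h1 _] _ _].
- by move=> k' t /gt[_ _ [_ h2] _ _].
- move=> k' h' kh; rewrite !derive_line x00.
  by rewrite -subr_eq0; apply: (Lv (k', h')).
- by move=> k' h'; rewrite x00; apply: b_nonres.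
- by move=> k' h'; rewrite x00; apply: F12_init.
- by move=> t /gt[hf [h1 _] _ [e1 _] _]; apply: gradient_line_equation.
- by move=> t /gt[hf [_ h2] _ [_ e2] _]; apply: gradient_line_equation.
- by move=> t /gt[_ _ _ _ hM]; apply: hM.
- by rewrite normr1 ltr1n.
Qed.

(** The direction from [x0] to [x] may be excluded by [generic_eq]. Moving [x] by [s *: v0] with
    small nonzero [s] makes it admissible, and regularity at [s = 0] gives equality at [x]
    itself. *)
Lemma holomorphic_uniqueness : \forall x \near x0, forall k h, F1 k h x = F2 k h x.
Proof.
have /nbhs_normP[r r0 hr] := near_good.
have [v0 hv0] : exists v, forall p,
    p \in [seq p <- enum {: 'I_n * 'I_n} | p.1 != p.2] -> L p v != 0.
  apply: common_nonzero => [i v w c|[k h]]; first exact: L_lin.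
  rewrite mem_filter => /andP[/= kh _].
  have [i hi] := diff_neq_delta (nbhs_singleton (f_holo h)) (nbhs_singleton (f_holo k))
    (fun e => df_neq kh (esym e)).
  by exists 'e_i; rewrite /L subr_eq0.
(* Half of the radius [r / 24] of [generic_eq]; the other half is for [s *: v0]. *)
have r48 : 0 < r / 48 by rewrite divr_gt0.
apply/nbhs_normP; exists (r / 48) => //= x xr k h.
pose u := x - x0; have ur : `|u| < r / 48 by rewrite /u distrC.
have nzL : \forall s \near 0^', forall p : 'I_n * 'I_n, p.1 != p.2 -> L p (u + s *: v0) != 0.
  apply: filter_forall => p; have [e|pn] := eqVneq p.1 p.2; first exact: filterE.
  have nz : (L p u != 0) || (L p v0 != 0).
    by rewrite hv0 ?orbT// mem_filter pn mem_enum.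
  by apply: filterS (near_affine_neq0 nz) => s hs _; rewrite L_lin.
move: nzL; rewrite near_withinE => /nbhs_normP[r1 /= r10 hr1].
have r20 : 0 < r / 48 / (`|v0| + 1) by rewrite divr_gt0// ltr_wpDl.
have [r2 r2_gt0 [r21 r22]] := common_radius r10 r20.
have xgood : good x.
  apply: hr; apply: lt_le_trans xr _.
  by rewrite ler_pdivrMr// ler_peMr ?(ltW r0)// ler1n.
case: (xgood) => _ [d1 d2] _ _ _.
pose g s := F1 k h (x + s *: v0) - F2 k h (x + s *: v0).
have xE : x + (0 : C) *: v0 = x by rewrite scale0r addr0.
have dg : derivable g 0 1.
  rewrite (_ : g = (fun s => F1 k h (x + s *: v0)) - (fun s => F2 k h (x + s *: v0)));
    last by apply/funext.
  by apply: derivableB; apply: derivable_line; rewrite xE.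
have g0 s : s != 0 -> `|s| < r2 -> g s = 0.
  move=> s0 sr; apply/eqP; rewrite subr_eq0; apply/eqP.
  have -> : x + s *: v0 = x0 + (u + s *: v0) by rewrite /u addrA addrCA subrr addr0.
  apply: (generic_eq k h r0 hr) => [p pn|].
    by apply: hr1 => //; rewrite /ball_ /= sub0r normrN (lt_le_trans sr).
  have -> : r / 24 = r / 48 + r / 48 by field.
  rewrite (le_lt_trans (ler_normD _ _))// ltrD// normrZ.
  apply: (@le_lt_trans _ _ (`|s| * (`|v0| + 1))); first by rewrite ler_wpM2l// lerDl.
  by rewrite -ltr_pdivlMr ?ltr_wpDl// (lt_le_trans sr).
apply/eqP; rewrite -subr_eq0 -xE -[X in X == 0]/(g 0) -oppr_eq0; apply/eqP.
(* Off 0 the function [g s - g 0] is the constant [- g 0], and it is [O(s)] by differentiability. *)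
apply: bigOX1_cst; apply: bigOX_ext r2_gt0 _ (bigOX_derivable1 dg) => s s0 sr.
by rewrite g0// sub0r.
Qed.

End Uniqueness.
End HolomorphicUniqueness.

(** * Taylor coefficients of degree 0 and 1 *)

Section TaylorLowOrder.
Variables (R : realType) (d : nat).
Local Notation C := (cplx R).
Implicit Types (f : 'rV[C]_d -> C) (x : 'rV[C]_d).

Lemma taylor_mindex0 x f : taylor x f (mindex0 d) = f x.
Proof.
rewrite /taylor /mpartial big1 ?divr1; last by move=> i _; rewrite ffunE.
by congr (_ x); elim: (enum 'I_d) => //= i s ->; rewrite ffunE.
Qed.

Lemma taylor_mindex1 x f i : taylor x f (mindex_incr i (mindex0 d)) = partial i f x.
Proof.
rewrite /taylor /mpartial big1 ?divr1; last first.
  by move=> j _; rewrite !ffunE; case: (j == i).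
congr (_ x); have : i \in enum 'I_d by rewrite mem_enum.
have := enum_uniq 'I_d; elim: (enum 'I_d) => //= j s IHs /andP[js us].
rewrite in_cons !ffunE; case: eqVneq => [ij _|ij /= si]; last by rewrite IHs.
(* The rest of the enumeration no longer contains [i], so it differentiates zero times. *)
rewrite ij /=; congr partial; move: js {us IHs}.
by rewrite -ij; elim: s => //= l s IHs; rewrite in_cons negb_or => /andP[il /IHs ->];
  rewrite !ffunE eq_sym (negbTE il).
Qed.

End TaylorLowOrder.

Unset Implicit Arguments.

Theorem theorem4p27 (R : realType) (d n : nat) (x0 : 'rV[cplx R]_d)
    (f : 'I_n -> 'rV[cplx R]_d -> cplx R) (b : 'I_n -> cplx R)
    (f_holo : forall k, holomorphic_near (f k) x0)
    (df_neq : forall k h, k != h ->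
       'd (f k) x0 <> 'd (f h) x0 :> ('rV[cplx R]_d -> cplx R))
    (b_nonres : forall k h, f h x0 = f k x0 ->
       forall m : int, m != 0 -> b h - b k <> m%:~R) :
  (forall F1 F2 : fps d 'M[cplx R]_n,
     formal_DE_solution x0 f b F1 -> formal_DE_solution x0 f b F2 ->
     F1 (mindex0 d) = F2 (mindex0 d) -> F1 = F2)
  /\
  (forall Fo : 'M[cplx R]_n, (forall k, Fo k k = 0) ->
   forall F1 F2 : 'rV[cplx R]_d -> 'M[cplx R]_n,
     holomorphic_DE_solution x0 f b F1 -> holomorphic_DE_solution x0 f b F2 ->
     F1 x0 = Fo -> F2 x0 = Fo ->
     \forall x \near x0, F1 x = F2 x).
Proof.
split=> [F1 F2 [diag1 sol1] [diag2 sol2] F12|Fo _ F1 F2].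
  apply/funext => al; apply/matrixP => k h.
  have := @formal_uniqueness R d n (fun k => taylor x0 (f k)) b
    (fun k h al => F1 al k h) (fun k h al => F2 al k h) _ _ _ _ sol1 sol2 _ k h.
  move/(_ _ _ _ _ _)/(congr1 (fun a => a al)); apply.
  - move=> {}k {}h kh.
    have [i hi] := @diff_neq_delta (cplx R) d (f h) (f k) x0 (nbhs_singleton (f_holo h))
      (nbhs_singleton (f_holo k)) (fun e => df_neq k h kh (esym e)).
    by exists i; rewrite !taylor_mindex1.
  - by move=> {}k {}h; rewrite !taylor_mindex0; apply: b_nonres.
  - by move=> l; apply/funext => be; apply: diag1.
  - by move=> l; apply/funext => be; apply: diag2.
  - by move=> {}k {}h; rewrite F12.
move=> [holo1 diag1 sol1] [holo2 diag2 sol2] init1 init2.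
(* On [C^o] scaling is multiplication and [partial] unfolds to ['D_'e_i], so this is the second
   family up to conversion. *)
have eq1 : \forall x \near x0, gradient_equation f b (fun k h y => F1 y k h) x.
  by apply: filterS sol1 => x [_ h] i k l kl; exact: h.
have eq2 : \forall x \near x0, gradient_equation f b (fun k h y => F2 y k h) x.
  by apply: filterS sol2 => x [_ h] i k l kl; exact: h.
have := @holomorphic_uniqueness (cplx R) (cplx_goursat_field R) d n x0 f b f_holo
  df_neq b_nonres (fun k h y => F1 y k h) (fun k h y => F2 y k h) holo1 holo2
  diag1 diag2 eq1 eq2.
have F12 : forall k h, F1 x0 k h = F2 x0 k h by rewrite init1 init2.
by move=> /(_ F12); apply: filterS => x F12x; apply/matrixP => k h; exact: F12x.
Qed.
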